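(* $$\sum_{n=0}^{\infty}\frac{w^n}{n+1}\sum_{k=0}^{n}\binom{n}{k}\frac{x^k}{(k+1)^{s-1}}=\frac{(-1)^{s-1}}{w\,\Gamma(s-1)}\int_0^1\frac{\log^{s-2}v\;\log[1-w(1+xv)]}{1+xv}\,dv.$$
   Context: $\Gamma$ is the gamma function and $\log^{s-2}v$ means $(\log v)^{s-2}$. *)

(* Defs.v *)
From HB Require Import structures.
From mathcomp Require Import all_boot all_order all_algebra.
From mathcomp Require Import all_classical all_reals all_analysis.
From mathcomp Require Import complex.
From mathcomp Require Import ring.

Set Implicit Arguments.
Unset Strict Implicit.
Unset Printing Implicit Defensive.

Import Order.TTheory GRing.Theory Num.Theory.
Import numFieldNormedType.Exports.

Local Open Scope classical_set_scope.
Local Open Scope ring_scope.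
Local Open Scope complex_scope.

Section ComplexFunctions.
Context {R : realType}.
Implicit Types (z w x s : R[i]) (r t v : R).

Definition cexp z : R[i] :=
  (expR (complex.Re z) * cos (complex.Im z))
    +i* (expR (complex.Re z) * sin (complex.Im z)).

(* Principal argument, in ]-pi, pi]; the value at 0 is irrelevant. *)
Definition carg z : R :=
  let a := acos (complex.Re z / complex.Re `|z|) in
  if 0 <= complex.Im z then a else - a.

Definition clog z : R[i] := ln (complex.Re `|z|) +i* carg z.

(* The determination of (r e^{it})^z, r > 0, attached to the argument t.      *)
(* When z is an integer it depends only on the base r e^{it}, not on the      *)
(* choice of its argument t: see polar_powX for the nonnegative case.         *)
Definition polar_pow r t z : R[i] := cexp (z * (ln r +i* t)).

Lemma cexpD z w : cexp (z + w) = cexp z * cexp w.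
Proof.
case: z w => [a b] [c d]; rewrite /cexp /= expRD cosD sinD.
by congr (_ +i* _); ring.
Qed.

Lemma polar_powX r t n : 0 < r ->
  polar_pow r t n%:R = (r%:C * (cos t +i* sin t)) ^+ n.
Proof.
move=> r0; rewrite /polar_pow; elim: n => [|n IHn].
  by rewrite mul0r expr0 /cexp /= expR0 cos0 sin0 mulr1 mulr0.
rewrite -natr1 mulrDl mul1r cexpD IHn exprSr; congr (_ * _).
rewrite /cexp /= lnK ?posrE//; apply/eqP.
by rewrite eq_complex /= !mul0r subr0 addr0 !eqxx.
Qed.

(* Lebesgue integrals of complex-valued functions, componentwise. *)
Definition cintegrable (D : set R) (f : R -> R[i]) : Prop :=
  (@lebesgue_measure R).-integrable D (EFin \o (fun v => complex.Re (f v))) /\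
  (@lebesgue_measure R).-integrable D (EFin \o (fun v => complex.Im (f v))).

Definition cintegral (D : set R) (f : R -> R[i]) : R[i] :=
  Rintegral (@lebesgue_measure R) D (fun v => complex.Re (f v))
    +i* Rintegral (@lebesgue_measure R) D (fun v => complex.Im (f v)).

(* Meaningful for 0 < Re z, the only range in which it is used. *)
Definition cGamma z : R[i] :=
  cintegral `]0, +oo[ (fun t => polar_pow t 0 (z - 1) * (expR (- t))%:C).

(* log^{s-2} v * log[1 - w(1+xv)] / (1+xv) for 0 < v < 1, where the negative  *)
(* number log v = |log v| e^{it} is given the argument t.                     *)
Definition rhs_integrand t w x s v : R[i] :=
  polar_pow `|ln v| t (s - 2%:R) * clog (1 - w * (1 + x * v%:C))
    / (1 + x * v%:C).

End ComplexFunctions.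

(* Main.v *)
Require Import Defs.
From HB Require Import structures.
From mathcomp Require Import all_boot all_order all_algebra.
From mathcomp Require Import all_classical all_reals all_analysis.
From mathcomp Require Import measurable_realfun.
From mathcomp Require Import complex.
From mathcomp Require Import ring lra.

Set Implicit Arguments.
Unset Strict Implicit.
Unset Printing Implicit Defensive.

Import Order.TTheory GRing.Theory Num.Theory.
Import numFieldNormedType.Exports.

Local Open Scope classical_set_scope.
Local Open Scope ring_scope.
Local Open Scope complex_scope.

(** Put sigma = s - 1, L = - ln v and z(v) = w (1 + x v).  The substitution
    v = exp (- t / b) in Euler's integral gives

      int_0^1 L^(sigma - 1) v^(b - 1) dv = Gamma(sigma) / b^sigma

    ([integral_log_kernel]).  Taking b = k + 1 and summing over k with the
    binomial theorem ([integral_kernel_binomial]), the n-th term of the series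
    is 1 / Gamma(sigma) times int_0^1 L^(sigma - 1) z(v)^n / (n + 1) dv.  Summing
    over n under the integral sign replaces the powers of z by - log (1 - z) / z.
    The remaining factors are phases: (log v)^(s - 2) carries e^(-i theta (s - 2))
    and (-1)^(s - 1) is e^(i theta (s - 1)); their product e^(i theta) = -1
    absorbs the sign of - log (1 - z).

    Three points need an argument.

    - The interchange of sum and integral ([integral_log_limit]) is by dominated
      convergence.  The point z(v) runs along a segment with both ends in the
      closed unit disc.  If the segment is not reduced to a point, strict
      convexity of the disc gives 1 - |z| >= h v (1 - v) >= h v^2 L, and since
      the partial sums of z^n / (n + 1) are at most 1 - ln (1 - |z|), they are
      O(L^(-c) v^(-2c)) for every c > 0 ([segment_psum_bound]); for c small,
      L^(Re sigma - 1 - c) v^(-2c) is integrable.  If x = 0, then z = w is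
      constant, and the partial sums are bounded because they converge.

    - The value of the logarithmic series is needed on the whole closed disc
      minus 1 ([log_series_cvg]).  Along u |-> u z the derivative of the n-th
      partial sum plus log (1 - u z) is O(u^n), so that the error at u = 1 is
      O(1 / (n + 1)).

    - Gamma(sigma) occurs in a denominator, so it must not vanish
      ([cGamma_neq0]).  By the functional equation a zero at sigma gives a zero
      at sigma + n for all n.  But for a = Re sigma + n large the weight
      t^(a - 1) e^(-t) concentrates around t = a, where t^(i tau) is close to
      a^(i tau), so the integral is close to a^(i tau) Gamma(a).

    The integrand of the theorem has value 0 at v = -1/x, where 1 + x v = 0; if
    that point lies in ]0, 1[, it is a null set and is removed before passing to
    the limit. *)

(** * Modulus, limits and integrals of complex functions *)

Section ComplexIntegral.
Context {R : realType}.
Implicit Types (z w s : R[i]) (D : set (measurableTypeR R)) (f g : R -> R[i]) (r t v : R).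

Notation mu := (@lebesgue_measure R).
Notation Re := complex.Re.
Notation Im := complex.Im.

(** Real-valued modulus, for comparisons with real integrands. *)
Definition cmod z : R := Re `|z|.

Lemma normc_cmod z : `|z| = (cmod z)%:C.
Proof. by rewrite /cmod normc_def. Qed.

Lemma cmodE z : cmod z = Num.sqrt (Re z ^+ 2 + Im z ^+ 2).
Proof. by rewrite /cmod normc_def. Qed.

Lemma cmod_sqr z : cmod z ^+ 2 = Re z ^+ 2 + Im z ^+ 2.
Proof. by rewrite cmodE sqr_sqrtr// addr_ge0// sqr_ge0. Qed.

Lemma cmod_ge0 z : 0 <= cmod z.
Proof. by rewrite cmodE sqrtr_ge0. Qed.

Lemma cmodM z w : cmod (z * w) = cmod z * cmod w.
Proof. by apply: complexI; rewrite rmorphM -!normc_cmod normrM. Qed.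

Lemma cmodX z n : cmod (z ^+ n) = cmod z ^+ n.
Proof. by apply: complexI; rewrite rmorphXn -!normc_cmod normrX. Qed.

Lemma cmodD z w : cmod (z + w) <= cmod z + cmod w.
Proof. by rewrite -lecR rmorphD/= -!normc_cmod ler_normD. Qed.

Lemma cmodV z : cmod z^-1 = (cmod z)^-1.
Proof. by apply: complexI; rewrite fmorphV -!normc_cmod normfV. Qed.

Lemma cmod_eq0 z : (cmod z == 0) = (z == 0).
Proof. by rewrite -(normr_eq0 z) normc_cmod; apply/eqP/eqP => [->//|[]]. Qed.

Lemma cmod_real r : cmod r%:C = `|r|.
Proof. by rewrite cmodE /= expr0n addr0 sqrtr_sqr. Qed.

Lemma cmod_nat n : cmod n%:R = n%:R.
Proof. by rewrite -(rmorph_nat (real_complex R)) cmod_real normr_nat. Qed.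

Lemma cmod_le1 z : `|z| <= 1 -> cmod z <= 1.
Proof. by rewrite normc_cmod -[1]/(1%:C) lecR. Qed.

Lemma normr_Re_le z : `|Re z| <= cmod z.
Proof.
by rewrite cmodE -sqrtr_sqr ler_wsqrtr// lerDl sqr_ge0.
Qed.

Lemma normr_Im_le z : `|Im z| <= cmod z.
Proof.
by rewrite cmodE -sqrtr_sqr ler_wsqrtr// lerDr sqr_ge0.
Qed.

Lemma cmod_le z : cmod z <= `|Re z| + `|Im z|.
Proof.
rewrite -(@ler_pXn2r _ 2)// ?nnegrE ?cmod_ge0 ?addr_ge0//.
rewrite cmod_sqr sqrrD !real_normK ?num_real// -addrA [leRHS]addrCA addrC.
rewrite addrC lerDr; apply: mulrn_wge0; exact: mulr_ge0.
Qed.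

Lemma ReD z w : Re (z + w) = Re z + Re w. Proof. by case: z w => [? ?] [? ?]. Qed.
Lemma ImD z w : Im (z + w) = Im z + Im w. Proof. by case: z w => [? ?] [? ?]. Qed.
Lemma ReN z : Re (- z) = - Re z. Proof. by case: z. Qed.
Lemma ImN z : Im (- z) = - Im z. Proof. by case: z. Qed.
Lemma ReM z w : Re (z * w) = Re z * Re w - Im z * Im w.
Proof. by case: z w => [? ?] [? ?]. Qed.
Lemma ImM z w : Im (z * w) = Re z * Im w + Im z * Re w.
Proof. by case: z w => [? ?] [? ?]. Qed.
Lemma Re_sum (I : Type) (s : seq I) (P : pred I) (F : I -> R[i]) :
  Re (\sum_(i <- s | P i) F i) = \sum_(i <- s | P i) Re (F i).
Proof. exact: (big_morph (@complex.Re R) ReD). Qed.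
Lemma Im_sum (I : Type) (s : seq I) (P : pred I) (F : I -> R[i]) :
  Im (\sum_(i <- s | P i) F i) = \sum_(i <- s | P i) Im (F i).
Proof. exact: (big_morph (@complex.Im R) ImD). Qed.

Lemma cvg_complex (u : nat -> R[i]) (l : R[i]) :
  (fun n => Re (u n)) @ \oo --> Re l -> (fun n => Im (u n)) @ \oo --> Im l ->
  (u : nat -> R[i]^o) @ \oo --> (l : R[i]^o).
Proof.
move=> /cvgrPdist_lt hR /cvgrPdist_lt hI; apply/cvgrPdist_lt => e e0.
have eE : e = (Re e)%:C by rewrite RRe_real// ger0_real// ltW.
have e2 : 0 < Re e / 2 by rewrite divr_gt0// -ltcR -eE.
near=> n.
rewrite eE normc_cmod ltcR (le_lt_trans (cmod_le _))//.
rewrite [Re e]splitr ltrD// ?ReD ?ImD ?ReN ?ImN; near: n.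
  exact: hR.
exact: hI.
Unshelve. all: by end_near. Qed.

(** Componentwise convergence is the form in which real limit theorems apply;
    [cvg_complex] turns it into convergence for the modulus. *)
Definition ccvg (u : nat -> R[i]) (l : R[i]) :=
  (fun n => Re (u n)) @ \oo --> Re l /\ (fun n => Im (u n)) @ \oo --> Im l.

Lemma ccvgM (u u' : nat -> R[i]) (l l' : R[i]) :
  ccvg u l -> ccvg u' l' -> ccvg (fun n => u n * u' n) (l * l').
Proof.
move=> [ul1 ul2] [ul1' ul2']; split.
  under eq_fun do rewrite ReM; rewrite ReM.
  by apply: cvgB; apply: cvgM.
under eq_fun do rewrite ImM; rewrite ImM.
by apply: cvgD; apply: cvgM.
Qed.

Lemma ccvg_cst (c : R[i]) : ccvg (fun=> c) c.
Proof. by split; exact: cvg_cst. Qed.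

Definition cmeasurable D f :=
  measurable_fun D (fun v : measurableTypeR R => Re (f v)) /\
  measurable_fun D (fun v : measurableTypeR R => Im (f v)).

Lemma cmeasurable_cst D (c : R[i]) : cmeasurable D (fun=> c).
Proof. by split; exact: measurable_cst. Qed.

Lemma cmeasurableM D f g :
  cmeasurable D f -> cmeasurable D g -> cmeasurable D (fun v => f v * g v).
Proof.
move=> [mf1 mf2] [mg1 mg2]; split.
  under eq_fun do rewrite ReM.
  by apply: measurable_funB; apply: measurable_funM.
under eq_fun do rewrite ImM.
by apply: measurable_funD; apply: measurable_funM.
Qed.

Lemma cmeasurableD D f g :
  cmeasurable D f -> cmeasurable D g -> cmeasurable D (fun v => f v + g v).
Proof.
move=> [mf1 mf2] [mg1 mg2]; split.
  under eq_fun do rewrite ReD.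
  exact: measurable_funD.
under eq_fun do rewrite ImD.
exact: measurable_funD.
Qed.

Lemma cmeasurable_sum D n (F : nat -> R -> R[i]) :
  (forall i, cmeasurable D (F i)) ->
  cmeasurable D (fun v => \sum_(0 <= i < n) F i v).
Proof.
move=> mF; elim: n => [|n IHn].
  under eq_fun do rewrite big_geq//; exact: cmeasurable_cst.
under eq_fun do rewrite big_nat_recr//=.
exact: cmeasurableD.
Qed.

Lemma cmeasurableX D f n :
  cmeasurable D f -> cmeasurable D (fun v => f v ^+ n).
Proof.
move=> mf; elim: n => [|n IHn]; first exact: cmeasurable_cst.
under eq_fun do rewrite exprS.
exact: cmeasurableM.
Qed.

Lemma cmeasurable_real D (h : R -> R) :
  measurable_fun D (h : measurableTypeR R -> R) -> cmeasurable D (fun v => (h v)%:C).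
Proof. by move=> mh; split => //=; exact: measurable_cst. Qed.

Lemma cintegrable_measurable D f : cintegrable D f -> cmeasurable D f.
Proof.
move=> [/integrableP[m1 _] /integrableP[m2 _]].
by split; apply/measurable_EFinP.
Qed.

Lemma cintegrable_le D f (g : R -> R) : measurable D -> cmeasurable D f ->
  (forall v, D v -> cmod (f v) <= g v) ->
  mu.-integrable D (EFin \o g) -> cintegrable D f.
Proof.
move=> mD [mf1 mf2] fg ig; split; apply: le_integrable ig => //=.
- exact/measurable_EFinP.
- move=> v Dv; rewrite lee_fin (le_trans (normr_Re_le _))//.
  by rewrite (le_trans (fg _ Dv))// ler_norm.
- exact/measurable_EFinP.
- move=> v Dv; rewrite lee_fin (le_trans (normr_Im_le _))//.
  by rewrite (le_trans (fg _ Dv))// ler_norm.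
Qed.

Lemma eq_cintegrable D f g : measurable D -> (forall v, D v -> f v = g v) ->
  cintegrable D f -> cintegrable D g.
Proof.
move=> mD fg [i1 i2]; split; [move: i1|move: i2]; apply: eq_integrable => // v;
  by rewrite inE => Dv /=; rewrite fg.
Qed.

Lemma eq_cintegral D f g : (forall v, D v -> f v = g v) ->
  cintegral D f = cintegral D g.
Proof.
by move=> fg; congr (_ +i* _); apply: eq_Rintegral => v; rewrite inE => Dv;
  rewrite fg.
Qed.

Lemma integrable_scale D (k : R) (h : R -> R) : measurable D ->
  mu.-integrable D (EFin \o h) ->
  mu.-integrable D (EFin \o (fun v => k * h v)).
Proof. by move=> mD ih; apply: eq_integrable (integrableZl mD k ih). Qed.

Lemma integrable_add D (h k : R -> R) : measurable D ->
  mu.-integrable D (EFin \o h) -> mu.-integrable D (EFin \o k) ->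
  mu.-integrable D (EFin \o (fun v => h v + k v)).
Proof. by move=> mD ih ik; apply: eq_integrable (integrableD mD ih ik). Qed.

Lemma cintegrableZl D (c : R[i]) f : measurable D -> cintegrable D f ->
  cintegrable D (fun v => c * f v).
Proof.
move=> mD [i1 i2]; split.
  apply: eq_integrable (integrableB mD (integrable_scale (Re c) mD i1)
    (integrable_scale (Im c) mD i2)) => // v _ /=.
  by rewrite ReM EFinB.
apply: eq_integrable (integrableD mD (integrable_scale (Re c) mD i2)
  (integrable_scale (Im c) mD i1)) => // v _ /=.
by rewrite ImM EFinD.
Qed.

Lemma cintegralZl D (c : R[i]) f : measurable D -> cintegrable D f ->
  cintegral D (fun v => c * f v) = c * cintegral D f.
Proof.
move=> mD [i1 i2].
apply/eqP; rewrite eq_complex ReM ImM /=; apply/andP; split; apply/eqP.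
  under eq_Rintegral do rewrite ReM.
  by rewrite RintegralB ?RintegralZl//; exact: integrable_scale.
under eq_Rintegral do rewrite ImM.
by rewrite RintegralD ?RintegralZl//; exact: integrable_scale.
Qed.

Lemma cintegrableD D f g : measurable D -> cintegrable D f ->
  cintegrable D g -> cintegrable D (fun v => f v + g v).
Proof.
move=> mD [i1 i2] [j1 j2]; split.
  by apply: eq_integrable (integrableD mD i1 j1) => // v _ /=;
    rewrite ReD EFinD.
by apply: eq_integrable (integrableD mD i2 j2) => // v _ /=;
  rewrite ImD EFinD.
Qed.

Lemma cintegralD D f g : measurable D -> cintegrable D f ->
  cintegrable D g ->
  cintegral D (fun v => f v + g v) = cintegral D f + cintegral D g.
Proof.
move=> mD [i1 i2] [j1 j2].
apply/eqP; rewrite eq_complex ReD ImD /=; apply/andP; split; apply/eqP.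
  by under eq_Rintegral do rewrite ReD; rewrite RintegralD.
by under eq_Rintegral do rewrite ImD; rewrite RintegralD.
Qed.

Lemma cintegral_sum D n (F : nat -> R -> R[i]) : measurable D ->
  (forall i, cintegrable D (F i)) ->
  cintegrable D (fun v => \sum_(0 <= i < n) F i v) /\
  cintegral D (fun v => \sum_(0 <= i < n) F i v) =
    \sum_(0 <= i < n) cintegral D (F i).
Proof.
move=> mD iF; elim: n => [|n [IH1 IH2]].
  under eq_fun do rewrite big_geq//.
  rewrite big_geq//; split.
    by split; exact: integrable0.
  rewrite /cintegral /=.
  by congr (_ +i* _); rewrite /Rintegral integral0.
rewrite big_nat_recr//= -IH2 -cintegralD//.
under eq_fun do rewrite big_nat_recr//=.
by split => //; exact: cintegrableD.
Qed.

(** Both components of a complex number are bounded by its modulus, so the real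
    theorem applies to each of them with the same dominating function. *)
Lemma cdominated_convergence D (F : nat -> R -> R[i]) f (g : R -> R) :
  measurable D -> (forall n, cmeasurable D (F n)) ->
  (forall v, D v -> ccvg (F ^~ v) (f v)) ->
  mu.-integrable D (EFin \o g) ->
  (forall n v, D v -> cmod (F n v) <= g v) ->
  cintegrable D f /\ ccvg (fun n => cintegral D (F n)) (cintegral D f).
Proof.
move=> mD mF Ff ig Fg.
have key (p : R[i] -> R) :
    (forall n, measurable_fun D (fun v : measurableTypeR R => p (F n v))) ->
    (forall v, D v -> (fun n => p (F n v)) @ \oo --> p (f v)) ->
    (forall z, `|p z| <= cmod z) ->
    mu.-integrable D (EFin \o (fun v => p (f v))) /\
    (fun n => Rintegral mu D (fun v => p (F n v))) @ \oo -->
      Rintegral mu D (fun v => p (f v)).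
  move=> mp cp lep.
  have H1 n : measurable_fun D (fun v : measurableTypeR R => (p (F n v))%:E).
    exact/measurable_EFinP.
  have H2 v : D v -> (fun n => (p (F n v))%:E) @ \oo --> (p (f v))%:E.
    by move=> Dv; apply: cvg_EFin (cp v Dv); exact: nearW.
  have H3 n v : D v -> (`|(p (F n v))%:E| <= (EFin \o g) v)%E.
    by move=> Dv; rewrite lee_fin (le_trans (lep _))// Fg.
  have H5 : measurable_fun D (fun v : measurableTypeR R => (p (f v))%:E).
    exact: emeasurable_fun_cvg H1 H2.
  have A1 : {ae mu, forall v, D v ->
      (fun n => (p (F n v))%:E) @ \oo --> (p (f v))%:E} by exact: aeW.
  have A2 : {ae mu, forall v n, D v -> (`|(p (F n v))%:E| <= (EFin \o g) v)%E}.
    by apply: aeW => v n; exact: H3.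
  have [i1 _ i2] := dominated_convergence mD H1 H5 A1 ig A2.
  split => //; apply: fine_cvg.
  by rewrite fineK//; exact: integrable_fin_num.
have [i1 c1] := key (@complex.Re R) (fun n => (mF n).1) (fun v Dv => (Ff v Dv).1) normr_Re_le.
have [i2 c2] := key (@complex.Im R) (fun n => (mF n).2) (fun v Dv => (Ff v Dv).2) normr_Im_le.
by split; split.
Qed.

End ComplexIntegral.

(** * The substitution v = exp(-ct) between ]0, 1[ and ]0, +oo[ *)

Section Substitution.
Context {R : realType}.
Notation mu := (@lebesgue_measure R).
Implicit Types (b c t v : R) (G f : R -> R).

(** An exhaustion of ]0, +oo[ by compact intervals: the integrands below may be
    singular at 0, so that results on segments are transported by a limit. *)
Definition shell (n : nat) : set (measurableTypeR R) := `[n.+1%:R^-1, n.+1%:R]%classic.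

Lemma shell_lt n : (0 : R) < n.+1%:R^-1.
Proof. by rewrite invr_gt0. Qed.

Lemma invSn_leSn n : (n.+1%:R^-1 : R) <= n.+1%:R.
Proof. by rewrite (@le_trans _ _ 1)// ?invf_le1// ler1n. Qed.

Lemma nondecreasing_shell : nondecreasing_seq shell.
Proof.
move=> m n mn; apply/subsetPset; apply: subset_itv; rewrite bnd_simp.
  by rewrite lef_pV2 ?posrE// ler_nat.
by rewrite ler_nat.
Qed.

Lemma bigcup_shell : \bigcup_n shell n = `]0, +oo[%classic.
Proof.
apply/seteqP; split => [t [n _]|t] /=.
  by rewrite /shell /= !in_itv/= andbT => /andP[+ _]; apply: lt_le_trans.
rewrite in_itv/= andbT => t0.
(* The index has to exceed both t and its inverse. *)
pose n := maxn (Num.truncn t) (Num.truncn t^-1).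
have tn : t <= n.+1%:R.
  rewrite ltW// (lt_le_trans (truncnS_gt _))//.
  by rewrite ler_nat ltnS leq_maxl.
have tVn : t^-1 <= n.+1%:R.
  rewrite ltW// (lt_le_trans (truncnS_gt _))//.
  by rewrite ler_nat ltnS leq_maxr.
exists n => //; rewrite /shell /= in_itv/= tn andbT.
by rewrite -[leRHS]invrK lef_pV2 ?posrE ?invr_gt0.
Qed.

(** The image of [shell n] under t |-> exp (- c t); these segments exhaust ]0, 1[. *)
Definition expshell c (n : nat) : set (measurableTypeR R) :=
  `[expR (- (c * n.+1%:R)), expR (- (c * n.+1%:R^-1))]%classic.

Lemma nondecreasing_expshell c : 0 < c -> nondecreasing_seq (expshell c).
Proof.
move=> c0 m n mn; apply/subsetPset; apply: subset_itv; rewrite bnd_simp.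
  by rewrite ler_expR lerN2 ler_pM2l// ler_nat.
by rewrite ler_expR lerN2 ler_pM2l// lef_pV2 ?posrE// ler_nat.
Qed.

Lemma bigcup_expshell c : 0 < c -> \bigcup_n expshell c n = `]0, 1[%classic.
Proof.
move=> c0; apply/seteqP; split => [v [n _]|v] /=.
  rewrite /expshell /= !in_itv/= => /andP[h1 h2].
  rewrite (lt_le_trans (expR_gt0 _) h1)/= (le_lt_trans h2)//.
  by rewrite expR_lt1 oppr_lt0 mulr_gt0.
rewrite in_itv/= => /andP[v0 v1].
have : (`]0, +oo[%classic : set R) (- ln v / c).
  by rewrite /= in_itv/= andbT divr_gt0// oppr_gt0 ln_lt0// v0.
rewrite -bigcup_shell => -[n _]; rewrite /shell /= in_itv/= => /andP[h1 h2].
exists n => //; rewrite /expshell/= in_itv/= -{1 2}(lnK v0).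
rewrite !ler_expR lerNl lerNr [c * _]mulrC -ler_pdivrMr// h2/=.
by rewrite mulrC -ler_pdivlMr.
Qed.

Lemma is_derive_expNM c t :
  is_derive t 1 (fun t => expR (- (c * t))) (- (c * expR (- (c * t)))).
Proof.
apply: is_derive_eq.
by rewrite /GRing.scale /=; ring.
Qed.

Lemma open_itv_measurable_fun (i : interval R) G :
  open [set` i] -> {in i, continuous G} ->
  measurable_fun ([set` i] : set (measurableTypeR R)) (G : measurableTypeR R -> R).
Proof.
move=> oi cG; apply: open_continuous_measurable_fun => // v.
by rewrite inE; exact: cG.
Qed.

(** The substitution holds on each segment of the exhaustion, and for a
    nonnegative integrand both sides pass to the limit by monotone convergence. *)
Lemma ge0_integral_expNM c G : 0 < c -> {in `]0, 1[, continuous G} ->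
  (forall v, v \in `]0, 1[ -> 0 <= G v) ->
  (\int[mu]_(v in `]0%R, 1%R[) (G v)%:E =
   \int[mu]_(t in `]0%R, +oo[) (G (expR (- (c * t))) * (c * expR (- (c * t))))%:E)%E.
Proof.
move=> c0 cG G0.
pose F t := expR (- (c * t)).
have F01 t : t \in `]0, +oo[ -> F t \in `]0, 1[.
  by rewrite !in_itv/= andbT => t0; rewrite expR_gt0 expR_lt1 oppr_lt0 mulr_gt0.
have dF t : derivable F t 1 by have [] := is_derive_expNM c t.
have F'E : (F : R -> R)^`()%classic = fun t => - (c * F t).
  by apply/funext => t; rewrite derive1E; have [_ ->] := is_derive_expNM c t.
have cF : continuous F.
  by move=> t; apply/differentiable_continuous/derivable1_diffP/dF.
have cF' : continuous (F : R -> R)^`()%classic.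
  by move=> t; rewrite F'E; apply: cvgN; apply: cvgMr; exact: cF.
have mG : measurable_fun (`]0, 1[ : set (measurableTypeR R)) (G : measurableTypeR R -> R).
  by apply: open_itv_measurable_fun => //; exact: interval_open.
have cGF : {in `]0, +oo[, continuous (fun t => G (F t) * (c * F t))}.
  move=> t t0; apply: cvgM; last by apply: cvgMr; exact: cF.
  apply: continuous_comp; first exact: cF.
  by apply: cG; exact: F01.
have mGF : measurable_fun (`]0, +oo[ : set (measurableTypeR R))
    (fun t : measurableTypeR R => G (F t) * (c * F t)).
  by apply: open_itv_measurable_fun => //; exact: interval_open.
rewrite -(bigcup_expshell c0) -bigcup_shell.
have ss n : shell n `<=` `]0, +oo[.
  by rewrite -bigcup_shell; exact: bigcup_sup.
have se n : expshell c n `<=` `]0, 1[.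
  by rewrite -(bigcup_expshell c0); exact: bigcup_sup.
have h1 := @ge0_nondecreasing_set_cvg_integral _ _ _ (expshell c)
  (fun v => (G v)%:E) mu (nondecreasing_expshell c0).
have h2 := @ge0_nondecreasing_set_cvg_integral _ _ _ shell
  (fun t => (G (F t) * (c * F t))%:E) mu nondecreasing_shell.
apply: cvg_unique (h1 _ _ _) _ => //.
- by move=> n; exact: measurable_itv.
- move=> n; apply/measurable_EFinP; apply: measurable_funS mG => //.
- by move=> n v /se /= v01; rewrite lee_fin G0.
have E : (fun n => \int[mu]_(v in expshell c n) (G v)%:E)%E =
    (fun n => \int[mu]_(t in shell n) (G (F t) * (c * F t))%:E)%E.
  apply/funext => n; rewrite /shell /expshell.
  rewrite (@integration_by_substitution_decreasing _ F G _ _ (invSn_leSn n)) //.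
  - by apply: eq_integral => t _; rewrite F'E /= opprK.
  - by move=> x y _ _ xy; rewrite ltr_expR ltrN2 ltr_pM2l.
  - apply/cvg_ex; exists ((F : R -> R)^`()%classic n.+1%:R^-1).
    by apply: cvg_at_right_filter; exact: cF'.
  - apply/cvg_ex; exists ((F : R -> R)^`()%classic n.+1%:R).
    by apply: cvg_at_left_filter; exact: cF'.
  - split => //.
    + by apply: cvg_at_right_filter; exact: cF.
    + by apply: cvg_at_left_filter; exact: cF.
  - apply: continuous_in_subspaceT => v.
    rewrite inE => /(se n) /= v01; exact: cG.
rewrite /= E; apply: h2.
- by move=> n; exact: measurable_itv.
- move=> n; apply/measurable_EFinP; apply: measurable_funS mGF => //.
- move=> n t /ss /= t0; rewrite lee_fin mulr_ge0 ?G0//; first exact: F01.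
  by rewrite mulr_ge0 ?expR_ge0// ltW.
Qed.

Lemma continuous_max0 G v : {for v, continuous G} ->
  {for v, continuous (fun v => Num.max (G v) 0)}.
Proof.
move=> cG; rewrite (_ : (fun v => _) = fun v => (G v + `|G v|) / 2); last first.
  by apply/funext => u; rewrite maxr_absE addr0 subr0.
by apply: cvgMl; apply: cvgD => //; exact: cvg_norm.
Qed.

(** The integral is by definition the difference of the integrals of the positive
    and negative parts, and the substitution respects these. *)
Lemma integral_expNM c G : 0 < c -> {in `]0, 1[, continuous G} ->
  (\int[mu]_(v in `]0%R, 1%R[) (G v)%:E =
   \int[mu]_(t in `]0%R, +oo[) (G (expR (- (c * t))) * (c * expR (- (c * t))))%:E)%E.
Proof.
move=> c0 cG.
rewrite integralE [in RHS]integralE; congr (_ - _)%E.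
  transitivity (\int[mu]_(v in `]0%R, 1%R[) (Num.max (G v) 0)%:E)%E.
    by apply: eq_integral => v _; rewrite funeposE EFin_max.
  rewrite (ge0_integral_expNM c0).
  - apply: eq_integral => t _; rewrite funeposE -EFin_max.
    by rewrite maxr_pMl ?mul0r// mulr_ge0 ?expR_ge0// ltW.
  - move=> v v01; apply: (@continuous_max0 G); exact: cG.
  - by move=> v _; rewrite le_max lexx orbT.
transitivity (\int[mu]_(v in `]0%R, 1%R[) (Num.max (- G v) 0)%:E)%E.
  by apply: eq_integral => v _; rewrite funenegE EFin_max.
rewrite (ge0_integral_expNM c0).
- apply: eq_integral => t _; rewrite funenegE -EFinN -EFin_max.
  by rewrite maxr_pMl ?mul0r ?mulNr// mulr_ge0 ?expR_ge0// ltW.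
- move=> v v01; apply: (@continuous_max0 (fun v => - G v)).
  by apply: cvgN; exact: cG.
- by move=> v _; rewrite le_max lexx orbT.
Qed.

End Substitution.

(** * Primitives and integrals over ]0, +oo[ *)

Section ImproperFTC.
Context {R : realType}.
Notation mu := (@lebesgue_measure R).
Implicit Types (F f : R -> R) (t : R).

Lemma integral_shell F f n : (forall t, 0 < t -> is_derive t 1 F (f t)) ->
  {in `]0, +oo[, continuous f} ->
  (\int[mu]_(t in shell n) (f t)%:E = (F n.+1%:R - F n.+1%:R^-1)%:E)%E.
Proof.
move=> dF cf; rewrite /shell; case: n => [|n].
  by rewrite invr1 set_itv1 integral_set1 subrr.
have lt1 : (n.+2%:R^-1 : R) < n.+2%:R.
  by rewrite (@lt_trans _ _ 1)// ?invf_lt1// ltr1n.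
have cF t : 0 < t -> {for t, continuous F}.
  by move=> /dF [/derivable1_diffP/differentiable_continuous].
rewrite (@continuous_FTC2 _ f F)// ?EFinB//.
- apply: continuous_in_subspaceT => t; rewrite inE/= in_itv/= => /andP[h _].
  by apply: cf; rewrite in_itv/= andbT (lt_le_trans _ h)// shell_lt.
- split.
  + move=> t; rewrite in_itv/= => /andP[h _].
    by have [] := dF t (lt_trans (shell_lt _) h).
  + by apply: cvg_at_right_filter; apply: cF; exact: shell_lt.
  + by apply: cvg_at_left_filter; exact: cF.
- move=> t; rewrite in_itv/= => /andP[h _]; rewrite derive1E.
  by have [_ ->] := dF t (lt_trans (shell_lt _) h).
Qed.

Lemma measurable_oy f : {in `]0, +oo[, continuous f} ->
  measurable_fun (`]0, +oo[ : set (measurableTypeR R)) (f : measurableTypeR R -> R).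
Proof. by move=> cf; apply: open_itv_measurable_fun => //; exact: interval_open. Qed.

Lemma shell_sub n : shell n `<=` (`]0, +oo[%classic : set R).
Proof. by rewrite -bigcup_shell; exact: bigcup_sup. Qed.

Lemma ge0_cvg_integral_shell f : {in `]0, +oo[, continuous f} ->
  (forall t, 0 < t -> 0 <= f t) ->
  (fun n => \int[mu]_(t in shell n) (f t)%:E)%E @ \oo -->
    (\int[mu]_(t in `]0%R, +oo[) (f t)%:E)%E.
Proof.
move=> cf f0; rewrite -bigcup_shell.
apply: ge0_nondecreasing_set_cvg_integral.
- exact: nondecreasing_shell.
- by move=> n; exact: measurable_itv.
- move=> n; apply/measurable_EFinP; apply: measurable_funS (measurable_oy cf) => //.
  exact: shell_sub.
- by move=> n t /shell_sub /=; rewrite in_itv/= andbT lee_fin; exact: f0.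
Qed.

(** The integrals over the exhaustion are increments of F, hence bounded. *)
Lemma bounded_primitive_integrable F f (M : R) :
  (forall t, 0 < t -> is_derive t 1 F (f t)) ->
  {in `]0, +oo[, continuous f} -> (forall t, 0 < t -> 0 <= f t) ->
  (forall t, 0 < t -> `|F t| <= M) ->
  mu.-integrable `]0, +oo[ (EFin \o f).
Proof.
move=> dF cf f0 FM; apply/integrableP; split.
  by apply/measurable_EFinP; exact: measurable_oy.
apply: (@le_lt_trans _ _ (M + M)%:E); last by rewrite ltry.
rewrite (_ : integral _ _ _ = \int[mu]_(t in `]0%R, +oo[) (f t)%:E)%E; last first.
  apply: eq_integral => t; rewrite inE/= in_itv/= andbT => t0.
  by rewrite ger0_norm// f0.
have h := ge0_cvg_integral_shell cf f0.
rewrite -(cvg_lim _ h)//; apply: lime_le.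
  by apply/cvg_ex; eexists; exact: h.
apply: nearW => n; rewrite (integral_shell n dF cf) lee_fin.
rewrite (le_trans (ler_norm _))// (le_trans (ler_normB _ _))//.
by rewrite lerD// FM// shell_lt.
Qed.

(** For an integrand of variable sign the integrals over the exhaustion converge
    because those of the positive and negative parts do, to finite limits. *)
Lemma integral_primitive F f (l a : R) :
  (forall t, 0 < t -> is_derive t 1 F (f t)) ->
  {in `]0, +oo[, continuous f} -> mu.-integrable `]0, +oo[ (EFin \o f) ->
  (fun n => F n.+1%:R) @ \oo --> l -> (fun n => F n.+1%:R^-1) @ \oo --> a ->
  Rintegral mu `]0, +oo[ f = l - a.
Proof.
move=> dF cf fi Fl Fa.
have mf := measurable_oy cf.
have h1 : (fun n => \int[mu]_(t in shell n) (f t)%:E)%E @ \oo --> (l - a)%:E.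
  under eq_fun do rewrite (integral_shell _ dF cf).
  by apply: cvg_EFin; [exact: nearW|exact: cvgB].
have hp : (fun n => \int[mu]_(t in shell n) (Num.max (f t) 0)%:E)%E @ \oo -->
    (\int[mu]_(t in `]0%R, +oo[) (Num.max (f t) 0)%:E)%E.
  apply: ge0_cvg_integral_shell => [t t0|t t0]; last by rewrite le_max lexx orbT.
  by apply: continuous_max0; exact: cf.
have hn : (fun n => \int[mu]_(t in shell n) (Num.max (- f t) 0)%:E)%E @ \oo -->
    (\int[mu]_(t in `]0%R, +oo[) (Num.max (- f t) 0)%:E)%E.
  apply: ge0_cvg_integral_shell => [t t0|t t0]; last by rewrite le_max lexx orbT.
  by apply: (@continuous_max0 _ (fun t => - f t)); apply: cvgN; exact: cf.
have split_int (D : set (measurableTypeR R)) : (\int[mu]_(t in D) (f t)%:E =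
    \int[mu]_(t in D) (Num.max (f t) 0)%:E - \int[mu]_(t in D) (Num.max (- f t) 0)%:E)%E.
  rewrite integralE; congr (_ - _)%E; apply: eq_integral => t _.
    by rewrite funeposE EFin_max.
  by rewrite funenegE EFin_max.
have h2 : (fun n => \int[mu]_(t in shell n) (f t)%:E)%E @ \oo -->
    (\int[mu]_(t in `]0%R, +oo[) (f t)%:E)%E.
  rewrite split_int; under eq_fun do rewrite split_int.
  apply: cvgeB => //.
  apply: fin_num_adde_defr.
  rewrite (_ : integral _ _ _ = \int[mu]_(t in `]0%R, +oo[) ((EFin \o f)^\+ t))%E.
    by apply: integrable_pos_fin_num.
  by apply: eq_integral => t _; rewrite funeposE EFin_max.
by rewrite /Rintegral (cvg_unique _ h2 h1).
Qed.

End ImproperFTC.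

(** * The gamma integral and its zeros *)

Section Gamma.
Context {R : realType}.
Notation mu := (@lebesgue_measure R).
Notation Re := complex.Re.
Notation Im := complex.Im.
Implicit Types (a b c t : R) (s z : R[i]).

Lemma polar_powE t s : polar_pow t 0 s =
  (expR (Re s * ln t) * cos (Im s * ln t)) +i* (expR (Re s * ln t) * sin (Im s * ln t)).
Proof. by case: s => p q; rewrite /polar_pow /cexp /= !mulr0 subr0 add0r. Qed.

Lemma cmod_polar_pow t s : cmod (polar_pow t 0 s) = expR (Re s * ln t).
Proof.
rewrite cmodE polar_powE /= !exprMn -mulrDr cos2Dsin2 mulr1.
by rewrite sqrtr_sqr ger0_norm// expR_ge0.
Qed.

Lemma polar_powD t s z : polar_pow t 0 (s + z) = polar_pow t 0 s * polar_pow t 0 z.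
Proof. by rewrite /polar_pow mulrDl cexpD. Qed.

Lemma polar_pow1 t : 0 < t -> polar_pow t 0 1 = t%:C.
Proof.
move=> t0; have := polar_powX 0 1 t0; rewrite expr1 cos0 sin0 => ->.
by rewrite -[RHS]mulr1.
Qed.

Lemma polar_pow_neq0 t s : polar_pow t 0 s != 0.
Proof. by rewrite -cmod_eq0 cmod_polar_pow gt_eqF// expR_gt0. Qed.

(** The integrand of Euler's integral for Gamma(s). *)
Definition gamma_kernel s t : R[i] := polar_pow t 0 (s - 1) * (expR (- t))%:C.

(** The modulus of [gamma_kernel]: it depends on the real part of s only. *)
Definition rgamma_kernel a t : R := expR ((a - 1) * ln t) * expR (- t).

Lemma gamma_kernelE s t : gamma_kernel s t =
  (rgamma_kernel (Re s) t * cos (Im s * ln t)) +i*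
  (rgamma_kernel (Re s) t * sin (Im s * ln t)).
Proof.
rewrite /gamma_kernel polar_powE /rgamma_kernel; case: s => p q /=.
apply/eqP; rewrite eq_complex /= !subr0 !mulr0 subr0 add0r.
by rewrite mulrAC eqxx mulrAC eqxx.
Qed.

Lemma cmod_gamma_kernel s t : cmod (gamma_kernel s t) = rgamma_kernel (Re s) t.
Proof.
rewrite /gamma_kernel cmodM cmod_polar_pow cmod_real ger0_norm ?expR_ge0//.
by case: s.
Qed.

Lemma ln_le_subr1 t : 0 < t -> ln t <= t - 1.
Proof.
by move=> t0; rewrite -[in leLHS](subrK 1 t) addrC le_ln1Dx// ltrBrDr addrC subrr.
Qed.

(** The logarithm lies below its tangent: a ln ((1 + t) / a) <= 1 + t - a. *)
Lemma expRN_le_pow a : 0 < a -> exists2 C, 0 < C & forall t, 0 < t ->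
  expR (- t) <= C * expR (- (a * ln (1 + t))).
Proof.
move=> a0; exists (expR (1 - a + a * ln a)); first exact: expR_gt0.
move=> t t0; rewrite -expRD ler_expR.
have t1 : 0 < 1 + t by rewrite addr_gt0.
have := ln_le_subr1 (divr_gt0 t1 a0).
rewrite ln_div ?posrE// -(ler_pM2l a0) mulrBr mulrBr mulr1 mulrCA divff ?gt_eqF//.
by lra.
Qed.

Lemma continuous_rgamma_kernel a : {in `]0, +oo[, continuous (rgamma_kernel a)}.
Proof.
move=> t; rewrite in_itv/= andbT => t0; apply: cvgM.
  apply: continuous_comp; last exact: continuous_expR.
  by apply: cvgMr; exact: continuous_ln.
apply: continuous_comp; last exact: continuous_expR.
exact: cvgN.
Qed.

(** The comparison function t^(a - 1) (1 + t)^(- a - 1) has the bounded primitive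
    (t / (1 + t))^a / a, and it dominates t^(a - 1) e^(-t) up to a constant. *)
Lemma rgamma_kernel_integrable a : 0 < a ->
  mu.-integrable `]0, +oo[ (EFin \o rgamma_kernel a).
Proof.
move=> a0.
(* h is the comparison function, in the form given by differentiating H. *)
pose H t : R := a^-1 * expR (a * (ln t - ln (1 + t))).
pose h t : R := expR (a * (ln t - ln (1 + t))) * (t^-1 - (1 + t)^-1).
have hE t : 0 < t -> h t = expR ((a - 1) * ln t) * expR (- ((a + 1) * ln (1 + t))).
  move=> t0; have t1 : 0 < 1 + t by rewrite addr_gt0.
  have -> : (a - 1) * ln t = a * ln t + ln t^-1 by rewrite lnV ?posrE//; lra.
  have -> : - ((a + 1) * ln (1 + t)) = - (a * ln (1 + t)) + ln (1 + t)^-1.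
    by rewrite lnV ?posrE//; lra.
  rewrite /h [a * (_ - _)]mulrBr !(@expRD R) !lnK ?posrE ?invr_gt0//.
  field.
  by rewrite !gt_eqF.
have ih : mu.-integrable `]0, +oo[ (EFin \o h).
  apply: (@bounded_primitive_integrable _ H h a^-1).
  - move=> t t0; have t1 : 0 < 1 + t by rewrite addr_gt0.
    have d1 := is_derive1_ln t0.
    have d2 : is_derive t 1 (fun t => ln (1 + t)) (1 + t)^-1.
      have := is_derive1_ln t1 => d; apply: is_derive_eq.
      by rewrite /GRing.scale /=; ring.
    apply: is_derive_eq.
    by rewrite /h /GRing.scale /=; field; rewrite !gt_eqF.
  - move=> t; rewrite in_itv/= andbT => t0.
    have t1 : 0 < 1 + t by rewrite addr_gt0.
    apply: cvgM.
      apply: continuous_comp; last exact: continuous_expR.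
      apply: cvgMr; apply: cvgB; first exact: continuous_ln.
      apply: continuous_comp; last exact: continuous_ln.
      by apply: cvgD; [exact: cvg_cst|exact: cvg_id].
    apply: cvgB; first by apply: cvgV; [rewrite gt_eqF|exact: cvg_id].
    apply: cvgV; first by rewrite gt_eqF.
    by apply: cvgD; [exact: cvg_cst|exact: cvg_id].
  - by move=> t t0; rewrite hE// mulr_ge0 ?expR_ge0.
  - move=> t t0; have t1 : 0 < 1 + t by rewrite addr_gt0.
    rewrite /H ger0_norm; last by rewrite mulr_ge0 ?expR_ge0// invr_ge0 ltW.
    rewrite ger_pMr ?invr_gt0// expR_le1 pmulr_rle0// subr_le0.
    by rewrite ler_ln ?posrE// lerDr.
have [C C0 hC] := @expRN_le_pow (a + 1) (addr_gt0 a0 ltr01).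
have := @integrable_scale _ `]0, +oo[%classic C h (measurable_itv _) ih.
apply: le_integrable => //=.
  apply/measurable_EFinP; apply: measurable_oy; exact: continuous_rgamma_kernel.
move=> t; rewrite in_itv/= andbT => t0; rewrite lee_fin.
rewrite ger0_norm; last by rewrite mulr_ge0 ?expR_ge0.
rewrite (le_trans _ (ler_norm _))// hE// mulrCA ler_wpM2l ?expR_ge0//.
exact: hC.
Qed.

Lemma continuous_gamma_kernel s :
  {in `]0, +oo[, continuous (fun t => Re (gamma_kernel s t))} /\
  {in `]0, +oo[, continuous (fun t => Im (gamma_kernel s t))}.
Proof.
have cl p : {in `]0, +oo[, continuous (fun t : R => p * ln t)}.
  by move=> t; rewrite in_itv/= andbT => t0; apply: cvgMr; exact: continuous_ln.
rewrite (funext (gamma_kernelE s)); split => t t0 /=.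
  apply: cvgM; first exact: continuous_rgamma_kernel.
  by apply: continuous_comp; [exact: cl|exact: continuous_cos].
apply: cvgM; first exact: continuous_rgamma_kernel.
by apply: continuous_comp; [exact: cl|exact: continuous_sin].
Qed.

Lemma gamma_kernel_measurable s : cmeasurable `]0, +oo[ (gamma_kernel s).
Proof.
by have [c1 c2] := continuous_gamma_kernel s; split; exact: measurable_oy.
Qed.

Lemma gamma_kernel_integrable s : 0 < Re s ->
  cintegrable `]0, +oo[ (gamma_kernel s).
Proof.
move=> s0; apply: (@cintegrable_le _ _ _ (rgamma_kernel (Re s))).
- exact: measurable_itv.
- exact: gamma_kernel_measurable.
- by move=> t _; rewrite cmod_gamma_kernel.
- exact: rgamma_kernel_integrable.
Qed.

Lemma cvg_expR_ln_invS a : 0 < a ->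
  (fun n => expR (a * ln n.+1%:R^-1)) @ \oo --> (0 : R).
Proof.
move=> a0; apply/cvgrPdist_lt => e e0.
have : 0 < expR (ln e / a) by exact: expR_gt0.
have /cvgrPdist_lt h := @cvg_harmonic R.
move=> /h h'; near=> n.
have : `|0 - harmonic n| < expR (ln e / a) by near: n.
rewrite !sub0r !normrN !ger0_norm ?expR_ge0 ?invr_ge0// => hn.
rewrite -[ltRHS]lnK ?posrE// ltr_expR -ltr_pdivlMl// mulrC.
by rewrite -(expRK (ln e / a)) ltr_ln ?posrE ?expR_gt0 ?invr_gt0.
Unshelve. all: by end_near. Qed.

Lemma cvg_expR_ln_sub a : 0 < a ->
  (fun n => expR (a * ln n.+1%:R) * expR (- n.+1%:R)) @ \oo --> (0 : R).
Proof.
move=> a0; have [C C0 hC] := @expRN_le_pow (a + 1) (addr_gt0 a0 ltr01).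
apply: (@squeeze_cvgr _ _ _ _ (fun=> 0) (fun n => C * harmonic n)).
- apply: nearW => n; rewrite mulr_ge0 ?expR_ge0//=.
  have n0 : (0 : R) < n.+1%:R by [].
  have n1 : (0 : R) < 1 + n.+1%:R by rewrite addr_gt0.
  rewrite (@le_trans _ _ (expR (a * ln n.+1%:R) * (C * expR (- ((a + 1) * ln (1 + n.+1%:R))))))//.
    by rewrite ler_wpM2l ?expR_ge0// hC.
  rewrite mulrCA ler_pM2l// -expRD -[leRHS]lnK ?posrE ?invr_gt0// ler_expR.
  rewrite lnV ?posrE//.
  have : ln n.+1%:R <= ln (1 + n.+1%:R) :> R by rewrite ler_ln ?posrE// lerDr.
  move=> hl; have := ler_wpM2l (ltW a0) hl; lra.
- exact: cvg_cst.
- by rewrite -[X in _ --> X](mulr0 C); apply: cvgMr; exact: cvg_harmonic.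
Qed.

(** The function t^s e^(-t) tends to 0 at both ends of ]0, +oo[, and its
    derivative is s t^(s - 1) e^(-t) - t^s e^(-t). *)
Lemma cGammaS s : 0 < Re s -> cGamma (s + 1) = s * cGamma s.
Proof.
move=> s0; have s10 : 0 < Re (s + 1) by rewrite ReD addr_gt0.
have i1 := gamma_kernel_integrable s0; have i2 := gamma_kernel_integrable s10.
have mD := @measurable_itv R `]0, +oo[.
pose f t := s * gamma_kernel s t - gamma_kernel (s + 1) t.
have fi : cintegrable `]0, +oo[ f.
  have -> : f = fun t => s * gamma_kernel s t + (-1) * gamma_kernel (s + 1) t.
    by apply/funext => t; rewrite mulN1r.
  by apply: cintegrableD => //; apply: cintegrableZl.
apply/esym/eqP; rewrite -subr_eq0; apply/eqP.
have <- : cintegral `]0, +oo[ f = s * cGamma s - cGamma (s + 1).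
  have -> : f = fun t => s * gamma_kernel s t + (-1) * gamma_kernel (s + 1) t.
    by apply/funext => t; rewrite mulN1r.
  rewrite cintegralD//; [|exact: cintegrableZl..].
  by rewrite !cintegralZl// mulN1r.
pose A t : R := expR (Re s * ln t) * expR (- t).
have gE t : 0 < t -> rgamma_kernel (Re s) t = A t / t.
  move=> t0; rewrite /rgamma_kernel /A.
  have -> : (Re s - 1) * ln t = Re s * ln t + ln t^-1 by rewrite lnV ?posrE//; ring.
  by rewrite expRD lnK ?posrE ?invr_gt0// mulrAC.
have g1E t : rgamma_kernel (Re (s + 1)) t = A t.
  by rewrite /rgamma_kernel ReD/= addrK.
have Im1 : Im (s + 1) = Im s by rewrite ImD/= addr0.
have RefE t : Re (f t) = Re s * Re (gamma_kernel s t) -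
    Im s * Im (gamma_kernel s t) - Re (gamma_kernel (s + 1) t).
  by rewrite /f ReD ReN ReM.
have ImfE t : Im (f t) = Re s * Im (gamma_kernel s t) +
    Im s * Re (gamma_kernel s t) - Im (gamma_kernel (s + 1) t).
  by rewrite /f ImD ImN ImM.
have dl t (t0 : 0 < t) := is_derive1_ln t0.
have dRe t : 0 < t -> is_derive t 1
    (fun t => expR (Re s * ln t) * expR (- t) * cos (Im s * ln t)) (Re (f t)).
  move=> t0; have d := dl t t0; apply: is_derive_eq.
  rewrite RefE !gamma_kernelE/= g1E Im1 gE// /A /GRing.scale/=.
  by field; rewrite gt_eqF.
have dIm t : 0 < t -> is_derive t 1
    (fun t => expR (Re s * ln t) * expR (- t) * sin (Im s * ln t)) (Im (f t)).
  move=> t0; have d := dl t t0; apply: is_derive_eq.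
  rewrite ImfE !gamma_kernelE/= g1E Im1 gE// /A /GRing.scale/=.
  by field; rewrite gt_eqF.
have [c1 c2] := continuous_gamma_kernel s.
have [c3 c4] := continuous_gamma_kernel (s + 1).
have cRe : {in `]0, +oo[, continuous (fun t => Re (f t))}.
  move=> t t0; rewrite (funext RefE); apply: cvgB; last exact: c3.
  by apply: cvgB; apply: cvgMr; [exact: c1|exact: c2].
have cIm : {in `]0, +oo[, continuous (fun t => Im (f t))}.
  move=> t t0; rewrite (funext ImfE); apply: cvgB; last exact: c4.
  by apply: cvgD; apply: cvgMr; [exact: c2|exact: c1].
have small (u B : nat -> R) : (forall n, `|u n| <= B n) -> B @ \oo --> (0 : R) ->
    u @ \oo --> (0 : R).
  move=> uB B0; apply: (@squeeze_cvgr _ _ _ _ (fun n => - B n) B) => //.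
    by apply: nearW => n; rewrite -ler_norml.
  by rewrite -oppr0; exact: cvgN.
have A_y (p : R -> R) : (forall t, `|p t| <= 1) ->
    (fun n => A n.+1%:R * p n.+1%:R) @ \oo --> (0 : R).
  move=> p1; apply: small (cvg_expR_ln_sub s0) => n.
  by rewrite normrM ger0_norm ?mulr_ge0 ?expR_ge0// ler_piMr ?mulr_ge0 ?expR_ge0.
have A_0 (p : R -> R) : (forall t, `|p t| <= 1) ->
    (fun n => A n.+1%:R^-1 * p n.+1%:R^-1) @ \oo --> (0 : R).
  move=> p1; apply: small (cvg_expR_ln_invS s0) => n.
  rewrite normrM ger0_norm ?mulr_ge0 ?expR_ge0//.
  rewrite (@le_trans _ _ (A n.+1%:R^-1))//.
    by rewrite ler_piMr// ?mulr_ge0 ?expR_ge0.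
  by rewrite /A ler_piMr ?expR_ge0// expR_le1 oppr_le0 invr_ge0.
have cos1 t : `|cos (Im s * ln t)| <= 1 by rewrite ler_norml cos_geN1 cos_le1.
have sin1 t : `|sin (Im s * ln t)| <= 1 by rewrite ler_norml sin_geN1 sin_le1.
rewrite /cintegral (integral_primitive dRe cRe fi.1 (A_y _ cos1) (A_0 _ cos1)).
by rewrite (integral_primitive dIm cIm fi.2 (A_y _ sin1) (A_0 _ sin1)) subrr.
Qed.

Lemma ler_sqr_normr (x y : R) : `|x| <= `|y| -> x ^+ 2 <= y ^+ 2.
Proof.
move=> xy; rewrite -(real_normK (num_real x)) -(real_normK (num_real y)).
by rewrite lerXn2r ?nnegrE.
Qed.

Lemma normr_sin_le t : `|sin t| <= `|t|.
Proof.
wlog t0 : t / 0 <= t => [H|].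
  have [/H//|/ltW] := leP 0 t.
  by rewrite -oppr_ge0 => /H; rewrite sinN !normrN.
have [c _] := @MVT_segment R sin cos 0 t t0 (fun x _ => is_derive_sin x)
  (continuous_subspaceT (@continuous_sin R)).
rewrite sin0 !subr0 => ->; rewrite normrM ler_piMl//; exact: cos_max.
Qed.

(** Since cos t = 1 - 2 sin^2 (t / 2) and |sin u| <= |u|. *)
Lemma cos_ge_quadratic t : 1 - t ^+ 2 / 2 <= cos t.
Proof.
have -> : cos t = 1 - sin (t / 2) ^+ 2 *+ 2.
  have {1}-> : t = (t / 2) *+ 2 by rewrite -mulr_natr divfK.
  by rewrite cos_mulr2n cos2sin2; ring.
rewrite lerD2l lerN2 -mulr_natr.
have -> : t ^+ 2 / 2 = (t / 2) ^+ 2 * 2 by field.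
by rewrite ler_pM2r// ler_sqr_normr// normr_sin_le.
Qed.

(** With q = sqrt t, the bounds 1 - 1/q <= ln q <= q - 1 give
    |ln q| <= |q - 1/q|, and (q - 1/q)^2 = t - 2 + 1/t. *)
Lemma ln_sqr_le t : 0 < t -> ln t ^+ 2 <= 4 * (t - 2 + t^-1).
Proof.
move=> t0; pose q := Num.sqrt t.
have q0 : 0 < q by rewrite sqrtr_gt0.
have tq : t = q ^+ 2 by rewrite sqr_sqrtr// ltW.
have l1 := ln_le_subr1 q0.
have qV0 : 0 < q^-1 by rewrite invr_gt0.
have := ln_le_subr1 qV0; rewrite lnV ?posrE// => l2.
have -> : 4 * (t - 2 + t^-1) = (2 * (q - q^-1)) ^+ 2.
  by rewrite tq; field; rewrite gt_eqF.
rewrite [in leLHS]tq lnXn// -[ln q *+ 2]mulr_natl; apply: ler_sqr_normr.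
rewrite !normrM ler_pM2l// ?normr_gt0//.
have [q1|q1] := leP 1 q.
  have qV1 : q^-1 <= 1 by rewrite invf_le1.
  by rewrite !ger0_norm; lra.
have qV1 : 1 <= q^-1 by rewrite invf_ge1// ltW.
by rewrite !ler0_norm; lra.
Qed.

Lemma rgamma_kernelS a t : 0 < t ->
  rgamma_kernel (a + 1) t = t * rgamma_kernel a t.
Proof.
move=> t0; rewrite /rgamma_kernel.
have -> : (a + 1 - 1) * ln t = ln t + (a - 1) * ln t by ring.
by rewrite expRD lnK ?posrE// mulrA.
Qed.

Lemma rgamma_kernel_ge0 a t : 0 <= rgamma_kernel a t.
Proof. by rewrite mulr_ge0 ?expR_ge0. Qed.

(** Gamma on the positive reals, where positivity of the integrand is available. *)
Definition rGamma a := Rintegral mu `]0, +oo[ (rgamma_kernel a).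

Lemma rGammaS a : 0 < a -> rGamma (a + 1) = a * rGamma a.
Proof.
move=> a0.
have E b : rGamma b = Re (cGamma b%:C).
  apply: eq_Rintegral => t _; rewrite -[RHS]/(Re (gamma_kernel b%:C t)).
  by rewrite gamma_kernelE /= mul0r cos0 mulr1.
rewrite !E rmorphD rmorph1 cGammaS// ReM /= mul0r subr0.
by [].
Qed.

Lemma rGamma_gt0 a : 1 <= a -> 0 < rGamma a.
Proof.
move=> a1; have a0 : 0 < a by rewrite (lt_le_trans ltr01).
have sub : `]1, 2[ `<=` (`]0, +oo[%classic : set (measurableTypeR R)).
  by move=> t /=; rewrite !in_itv/= andbT => /andP[t1 _]; rewrite (lt_trans ltr01).
have ia := rgamma_kernel_integrable a0.
suff : expR (- 2) <= rGamma a by apply: lt_le_trans; exact: expR_gt0.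
rewrite -lee_fin /rGamma /Rintegral fineK; last by apply: integrable_fin_num.
apply: (@le_trans _ _ (\int[mu]_(t in `]1%R, 2%R[) (expR (- 2))%:E)%E).
  rewrite integral_cst//= lebesgue_measure_itv/= lte_fin ltr1n -EFinD.
  by rewrite -EFinM (_ : 2 - 1 = 1) ?mulr1//; ring.
apply: (@le_trans _ _ (\int[mu]_(t in `]1%R, 2%R[) (rgamma_kernel a t)%:E)%E).
  apply: ge0_le_integral => //.
  - apply/measurable_EFinP; apply: measurable_funS sub _ => //.
    by apply: measurable_oy; exact: continuous_rgamma_kernel.
  - move=> t /=; rewrite in_itv/= => /andP[t1 t2]; rewrite lee_fin.
    rewrite /rgamma_kernel -expRD ler_expR -[leLHS]add0r lerD ?lerN2 ?(ltW t2)//.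
    by rewrite mulr_ge0 ?subr_ge0// ln_ge0// ltW.
apply: ge0_subset_integral => //.
- by apply/measurable_EFinP; apply: measurable_oy; exact: continuous_rgamma_kernel.
- by move=> t _; rewrite lee_fin rgamma_kernel_ge0.
Qed.

(** After multiplication by a^(- i tau), where s = a + i tau, the real part of the
    integrand is t^(a - 1) e^(-t) cos (tau ln (t / a)).  It is bounded below by
    t^(a - 1) e^(-t) (1 - k (t / a - 2 + a / t)) with k = 2 tau^2, and by the
    functional equation the integral of the latter is
    Gamma(a) (1 - k / (a - 1)), which is positive. *)
Lemma cGamma_neq0_large s : 1 < Re s -> 2 * Im s ^+ 2 < Re s - 1 ->
  cGamma s != 0.
Proof.
set a := Re s; set k := 2 * Im s ^+ 2 => a1 ka.
have a0 : 0 < a by rewrite (lt_trans ltr01).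
have am0 : 0 < a - 1 by rewrite subr_gt0.
have mD : measurable (`]0, +oo[%classic : set (measurableTypeR R)).
  exact: measurable_itv.
(* c is a^(- i tau). *)
pose c := cos (Im s * ln a) -i* sin (Im s * ln a).
have ics := cintegrableZl c mD (gamma_kernel_integrable a0).
have RecE t : Re (c * gamma_kernel s t) =
    rgamma_kernel a t * cos (Im s * ln t - Im s * ln a).
  by rewrite ReM gamma_kernelE /= cosB; ring.
(* L is the lower bound, expanded into gamma integrands of parameters
   a, a + 1 and a - 1. *)
pose L t := ((1 + 2 * k) * rgamma_kernel a t +
  (- (k / a)) * rgamma_kernel (a + 1) t) + (- (k * a)) * rgamma_kernel (a - 1) t.
have k0 : 0 <= k by rewrite mulr_ge0 ?sqr_ge0.
have Lle t : 0 < t -> L t <= Re (c * gamma_kernel s t).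
  move=> t0; rewrite RecE /L rgamma_kernelS//.
  have -> : rgamma_kernel a t = t * rgamma_kernel (a - 1) t.
    by rewrite -rgamma_kernelS// subrK.
  set g := rgamma_kernel (a - 1) t.
  have g0 : 0 <= g by exact: rgamma_kernel_ge0.
  have ta : 0 < t / a by rewrite divr_gt0.
  rewrite -mulrBr -ln_div ?posrE//.
  have h1 := cos_ge_quadratic (Im s * ln (t / a)).
  have h2 := ler_wpM2l (sqr_ge0 (Im s)) (ln_sqr_le ta).
  have h3 : 1 - k * (t / a - 2 + (t / a)^-1) <= cos (Im s * ln (t / a)).
    apply: le_trans h1; rewrite exprMn /k; lra.
  have tg0 : 0 <= t * g by rewrite mulr_ge0// ltW.
  apply: le_trans (ler_wpM2l tg0 h3); rewrite le_eqVlt; apply/orP; left.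
  by apply/eqP; field; rewrite !gt_eqF.
have i1 := integrable_scale (1 + 2 * k) mD (rgamma_kernel_integrable a0).
have i2 := integrable_scale (- (k / a)) mD (rgamma_kernel_integrable (addr_gt0 a0 ltr01)).
have i3 := integrable_scale (- (k * a)) mD (rgamma_kernel_integrable am0).
have i12 : mu.-integrable `]0, +oo[ (EFin \o (fun t => (1 + 2 * k) * rgamma_kernel a t +
  (- (k / a)) * rgamma_kernel (a + 1) t)).
  exact: integrable_add.
have iL : mu.-integrable `]0, +oo[ (EFin \o L).
  exact: integrable_add.
have intL : Rintegral mu `]0, +oo[ L = rGamma a * (1 - k / (a - 1)).
  rewrite RintegralD// RintegralD// !RintegralZl//; last 3 first.
  - exact: rgamma_kernel_integrable.
  - exact: rgamma_kernel_integrable (addr_gt0 a0 ltr01).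
  - exact: rgamma_kernel_integrable.
  rewrite -!/(rGamma _) rGammaS//.
  have := rGammaS am0; rewrite subrK => ->.
  by field; rewrite !gt_eqF.
apply/negP => /eqP G0.
have : 0 < Rintegral mu `]0, +oo[ L.
  rewrite intL mulr_gt0 ?rGamma_gt0 ?ltW// subr_gt0 ltr_pdivrMr// mul1r.
  exact: ka.
apply/negP; rewrite -leNgt.
have E : Rintegral mu `]0, +oo[ (fun t => Re (c * gamma_kernel s t)) = 0.
  rewrite -[LHS]/(Re (cintegral `]0, +oo[ (fun t => c * gamma_kernel s t))).
  by rewrite cintegralZl ?[cintegral _ _]G0 ?mulr0//; exact: gamma_kernel_integrable.
rewrite -[X in _ <= X]E; apply: le_Rintegral => //; first exact: ics.1.
by move=> t; rewrite /= in_itv/= andbT; exact: Lle.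
Qed.

(** The functional equation shifts a zero to the right until the previous lemma
    excludes it. *)
Lemma cGamma_neq0 s : 0 < Re s -> cGamma s != 0.
Proof.
move=> s0.
have Gn n : cGamma s = 0 -> cGamma (s + n%:R) = 0.
  move=> G0; elim: n => [|n IHn]; first by rewrite addr0.
  rewrite -natr1 addrA cGammaS ?IHn ?mulr0// ReD.
  by rewrite -(rmorph_nat (real_complex R))/= ltr_wpDr.
apply/negP => /eqP G0.
(* Any n > 1 + 2 tau^2 makes s + n satisfy the previous lemma. *)
pose n := (Num.truncn (2 * Im s ^+ 2 + 1)).+1.
have hn : 2 * Im s ^+ 2 + 1 < n%:R :> R by exact: truncnS_gt.
have /eqP := Gn n G0; apply/negP; apply: cGamma_neq0_large.
  rewrite ReD -(rmorph_nat (real_complex R))/=.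
  have := sqr_ge0 (Im s); lra.
rewrite ReD ImD -(rmorph_nat (real_complex R))/= addr0; lra.
Qed.

End Gamma.

(** * Logarithmic moments on ]0, 1[ *)

Section LogMoments.
Context {R : realType}.
Notation mu := (@lebesgue_measure R).
Notation Re := complex.Re.
Notation Im := complex.Im.
Implicit Types (a b c t v : R) (s z : R[i]).

Lemma cintegral_expNM c (f : R -> R[i]) : 0 < c ->
  {in `]0, 1[, continuous (fun v => Re (f v))} ->
  {in `]0, 1[, continuous (fun v => Im (f v))} ->
  cintegrable `]0, +oo[
    (fun t => (c * expR (- (c * t)))%:C * f (expR (- (c * t)))) ->
  cintegrable `]0, 1[ f /\
  cintegral `]0, 1[ f = cintegral `]0, +oo[
    (fun t => (c * expR (- (c * t)))%:C * f (expR (- (c * t)))).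
Proof.
move=> c0 cR cI [i1 i2].
have key (p : R -> R) (q : R -> R) : {in `]0, 1[, continuous p} ->
    (forall t, q t = p (expR (- (c * t))) * (c * expR (- (c * t)))) ->
    mu.-integrable `]0, +oo[ (EFin \o q) ->
    mu.-integrable `]0, 1[ (EFin \o p) /\
    Rintegral mu `]0, 1[ p = Rintegral mu `]0, +oo[ q.
  move=> cp qE /integrableP[_ iq]; split.
    apply/integrableP; split.
      by apply/measurable_EFinP; apply: open_itv_measurable_fun.
    rewrite (_ : integral _ _ _ = \int[mu]_(v in `]0%R, 1%R[) (`|p v|)%:E)%E//.
    rewrite (ge0_integral_expNM c0)//; last first.
      by move=> v v01; apply: cvg_norm; exact: cp.
    apply: le_lt_trans iq; rewrite le_eqVlt; apply/orP; left; apply/eqP.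
    apply: eq_integral => t _ /=; rewrite qE normrM.
    by rewrite [`|c * _|]ger0_norm// mulr_ge0 ?expR_ge0// ltW.
  rewrite /Rintegral (integral_expNM c0 cp); congr fine.
  by apply: eq_integral => t _ /=; rewrite qE.
have [t|j1 e1] := key _ _ cR _ i1; first by rewrite ReM /= mul0r subr0 mulrC.
have [t|j2 e2] := key _ _ cI _ i2; first by rewrite ImM /= mul0r addr0 mulrC.
by split; [split|congr (_ +i* _)].
Qed.

Lemma polar_pow_div a b z : 0 < a -> 0 < b ->
  polar_pow (a / b) 0 z = polar_pow a 0 z / polar_pow b 0 z.
Proof.
move=> a0 b0; apply: (mulIf (polar_pow_neq0 b z)).
rewrite divfK ?polar_pow_neq0// /polar_pow -cexpD -mulrDr; congr (cexp (_ * _)).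
apply/eqP; rewrite eq_complex /= addr0 eqxx andbT.
by rewrite ln_div ?posrE// subrK.
Qed.

(** The function (- ln v)^(s - 1) v^(b - 1) on ]0, 1[. *)
Definition log_kernel s b v : R[i] :=
  polar_pow (- ln v) 0 (s - 1) * (expR ((b - 1) * ln v))%:C.

(** The modulus of [log_kernel]; these functions also serve as dominating
    functions. *)
Definition rlog_kernel a b v : R :=
  expR ((a - 1) * ln (- ln v)) * expR ((b - 1) * ln v).

Lemma cmod_log_kernel s b v : cmod (log_kernel s b v) = rlog_kernel (Re s) b v.
Proof.
by rewrite cmodM cmod_polar_pow cmod_real ger0_norm ?expR_ge0// ReD.
Qed.

Lemma log_kernelE s b v : log_kernel s b v =
  (rlog_kernel (Re s) b v * cos (Im s * ln (- ln v))) +i*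
  (rlog_kernel (Re s) b v * sin (Im s * ln (- ln v))).
Proof.
rewrite /log_kernel polar_powE /rlog_kernel; case: s => p q /=.
apply/eqP; rewrite eq_complex /= !subr0 !mulr0 subr0 add0r.
by rewrite mulrAC eqxx mulrAC eqxx.
Qed.

Lemma continuous_log_kernel s b :
  {in `]0, 1[, continuous (fun v => Re (log_kernel s b v))} /\
  {in `]0, 1[, continuous (fun v => Im (log_kernel s b v))}.
Proof.
have cl p : {in `]0, 1[, continuous (fun v : R => p * ln (- ln v))}.
  move=> v; rewrite in_itv/= => /andP[v0 v1].
  apply: cvgMr; apply: continuous_comp; last first.
    by apply: continuous_ln; rewrite oppr_gt0 ln_lt0// v0.
  by apply: cvgN; exact: continuous_ln.
have cr : {in `]0, 1[, continuous (rlog_kernel (Re s) b)}.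
  move=> v v01; apply: cvgM.
    by apply: continuous_comp; [exact: cl|exact: continuous_expR].
  apply: continuous_comp; last exact: continuous_expR.
  apply: cvgMr; apply: continuous_ln.
  by move: v01; rewrite in_itv/= => /andP[].
rewrite (funext (log_kernelE s b)); split => v v01 /=.
  apply: cvgM; first exact: cr.
  by apply: continuous_comp; [exact: cl|exact: continuous_cos].
apply: cvgM; first exact: cr.
by apply: continuous_comp; [exact: cl|exact: continuous_sin].
Qed.

Lemma log_kernel_subst s b t : 0 < b -> 0 < t ->
  (b^-1 * expR (- (b^-1 * t)))%:C * log_kernel s b (expR (- (b^-1 * t))) =
  (polar_pow b 0 s)^-1 * gamma_kernel s t.
Proof.
move=> b0 t0; rewrite /log_kernel expRK opprK [b^-1 * t]mulrC.
rewrite polar_pow_div// /gamma_kernel.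
have -> : polar_pow b 0 s = polar_pow b 0 (s - 1) * b%:C.
  by rewrite -(polar_pow1 b0) -polar_powD subrK.
have -> : expR (- t) = expR (- (t / b)) * expR ((b - 1) * - (t / b)).
  by rewrite -expRD; congr expR; field; rewrite gt_eqF.
rewrite !rmorphM/= fmorphV invfM; ring.
Qed.

(** The substitution v = exp (- t / b) maps [log_kernel s b] to the Euler
    integrand divided by b^s ([log_kernel_subst]). *)
Lemma integral_log_kernel s b : 0 < Re s -> 0 < b ->
  cintegrable `]0, 1[ (log_kernel s b) /\
  cintegral `]0, 1[ (log_kernel s b) = cGamma s / polar_pow b 0 s.
Proof.
move=> s0 b0; have bV0 : 0 < b^-1 by rewrite invr_gt0.
have [c1 c2] := continuous_log_kernel s b.
have mD : measurable (`]0, +oo[%classic : set (measurableTypeR R)).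
  exact: measurable_itv.
have E t : `]0, +oo[%classic t -> (polar_pow b 0 s)^-1 * gamma_kernel s t =
    (b^-1 * expR (- (b^-1 * t)))%:C * log_kernel s b (expR (- (b^-1 * t))).
  by rewrite /= in_itv/= andbT => t0; rewrite log_kernel_subst.
have ig := gamma_kernel_integrable s0.
have [|i e] := cintegral_expNM bV0 c1 c2.
  by apply: eq_cintegrable E _ => //; exact: cintegrableZl.
split => //; rewrite e -(eq_cintegral E) cintegralZl// mulrC.
by [].
Qed.

Lemma rlog_kernel_integrable a b : 0 < a -> 0 < b ->
  mu.-integrable `]0, 1[ (EFin \o rlog_kernel a b).
Proof.
move=> a0 b0; have [[i _] _] := @integral_log_kernel a%:C b a0 b0.
apply: eq_integrable i => // v _ /=; congr EFin.
by rewrite -[LHS]/(Re (log_kernel a%:C b v)) log_kernelE /= mul0r cos0 mulr1.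
Qed.

End LogMoments.

(** * The logarithmic series on the closed unit disc *)

Section LogSeries.
Context {R : realType}.
Notation Re := complex.Re.
Notation Im := complex.Im.
Implicit Types (z : R[i]) (p q r u v : R).

(** In the right half-plane the argument is given by a differentiable formula. *)
Lemma carg_atan p q : 0 < p -> carg (p +i* q) = atan (q / p).
Proof.
move=> p0; rewrite /carg -[complex.Re `|_|]/(cmod _) cmodE /=.
set m := Num.sqrt _.
have h (y : R) : 0 <= y -> acos (p / Num.sqrt (p ^+ 2 + y ^+ 2)) = atan (y / p).
  move=> y0.
  have e : p / Num.sqrt (p ^+ 2 + y ^+ 2) = cos (atan (y / p)).
    rewrite cos_atan.
    have -> : 1 + (y / p) ^+ 2 = (p ^+ 2 + y ^+ 2) / p ^+ 2.
      by field; rewrite gt_eqF.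
    rewrite sqrtrM ?addr_ge0 ?sqr_ge0// sqrtrV ?sqr_ge0// sqrtr_sqr gtr0_norm//.
    by rewrite invfM invrK mulrC.
  rewrite e cosK// in_itv/= -atan0 le_atan ?divr_ge0 ?(ltW p0)//=.
  by rewrite ltW// (lt_le_trans (atan_ltpi2 _))// ler_pdivrMr// ler_peMr ?pi_ge0// ler1n.
have [q0|q0] := leP 0 q; first exact: h.
have := h (- q); rewrite sqrrN -/m => -> //; last by rewrite oppr_ge0 ltW.
by rewrite mulNr atanN opprK.
Qed.

Lemma clogE p q : 0 < p ->
  clog (p +i* q) = (ln (p ^+ 2 + q ^+ 2) / 2) +i* atan (q / p).
Proof.
move=> p0; rewrite /clog carg_atan// -[complex.Re `|_|]/(cmod _) cmodE /=; congr (_ +i* _).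
have m0 : 0 < p ^+ 2 + q ^+ 2 by rewrite ltr_wpDr ?sqr_ge0// exprn_gt0.
rewrite -{2}(sqr_sqrtr (ltW m0)) lnXn ?sqrtr_gt0//.
by rewrite -[_ *+ 2]mulr_natr mulfK.
Qed.

Definition log_psum n z : R[i] := \sum_(0 <= k < n) z ^+ k.+1 / k.+1%:R.

Lemma nat_complex n : (n%:R : R[i]) = (n%:R : R)%:C.
Proof. by rewrite -(rmorph_nat (real_complex R)). Qed.

Lemma Re_divn z n : Re (z / n.+1%:R) = Re z / n.+1%:R.
Proof. by rewrite nat_complex -fmorphV ReM /= mulr0 subr0. Qed.

Lemma Im_divn z n : Im (z / n.+1%:R) = Im z / n.+1%:R.
Proof. by rewrite nat_complex -fmorphV ImM /= mulr0 add0r. Qed.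

Lemma realX u n : (u%:C ^+ n : R[i]) = (u ^+ n)%:C.
Proof. by rewrite rmorphXn. Qed.

Lemma Re_log_psum n z u : Re (log_psum n (z * u%:C)) =
  \sum_(0 <= k < n) Re (z ^+ k.+1) / k.+1%:R * u ^+ k.+1.
Proof.
rewrite Re_sum; apply: eq_bigr => k _.
by rewrite Re_divn exprMn realX ReM /= mulr0 subr0 mulrAC.
Qed.

Lemma Im_log_psum n z u : Im (log_psum n (z * u%:C)) =
  \sum_(0 <= k < n) Im (z ^+ k.+1) / k.+1%:R * u ^+ k.+1.
Proof.
rewrite Im_sum; apply: eq_bigr => k _.
by rewrite Im_divn exprMn realX ImM /= mulr0 add0r mulrAC.
Qed.

Lemma is_derive_monomial (a : R) n u :
  is_derive u 1 (fun u => a * u ^+ n.+1) (a * n.+1%:R * u ^+ n).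
Proof.
have h := is_deriveZ a (is_deriveX n.+1 (@is_derive_id R R^o u 1)).
have E : a \*: ((@id R^o) ^+ n.+1 : R -> R) = fun u => a * u ^+ n.+1.
  by apply/funext => v; rewrite /= exprfctE.
rewrite E in h; apply: is_derive_eq h _; rewrite /GRing.scale /=; ring.
Qed.

Lemma is_derive_psum (c : nat -> R) n u :
  is_derive u 1 (fun u => \sum_(0 <= k < n) c k / k.+1%:R * u ^+ k.+1)
    (\sum_(0 <= k < n) c k * u ^+ k).
Proof.
elim: n => [|n IHn].
  under eq_fun do rewrite big_geq//; rewrite big_geq//.
  exact: is_derive_cst.
under eq_fun do rewrite big_nat_recr//=; rewrite big_nat_recr//=.
have h : is_derive u 1 (fun u => c n / n.+1%:R * u ^+ n.+1) (c n * u ^+ n).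
  by have := is_derive_monomial (c n / n.+1%:R) n u; rewrite divfK ?pnatr_eq0.
exact: is_deriveD.
Qed.

Lemma geometric_remainder n z : 1 - z != 0 ->
  \sum_(0 <= k < n) z ^+ k - (1 - z)^-1 = - z ^+ n / (1 - z).
Proof.
move=> z1; apply: (mulIf z1); rewrite mulrBl mulVf// divfK//.
rewrite big_mkord mulrC.
have := subrXX 1 z n; rewrite expr1n => h.
have -> : (1 - z) * \sum_(i < n) z ^+ i = 1 - z ^+ n.
  by rewrite h; congr (_ * _); apply: eq_bigr => i _; rewrite expr1n mul1r.
by rewrite addrAC subrr add0r.
Qed.

(** For e = 1 and e = -1 the function M u^(n+1) / (n+1) - e f(u) is nondecreasing.
    The mean value theorem alone would lose the factor 1 / (n+1). *)
Lemma small_derivative_bound (f df : R -> R) (M : R) n :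
  (forall u, 0 <= u <= 1 -> is_derive u 1 f (df u)) ->
  (forall u, 0 <= u <= 1 -> `|df u| <= M * u ^+ n) ->
  `|f 1 - f 0| <= M / n.+1%:R.
Proof.
move=> d le.
have key (e : R) : `|e| = 1 -> e * (f 1 - f 0) <= M / n.+1%:R.
  move=> e1.
  pose g u := M / n.+1%:R * u ^+ n.+1 - e * f u.
  have dg u : 0 <= u <= 1 -> is_derive u 1 g (M * u ^+ n - e * df u).
    move=> u01; apply: is_deriveB; last exact: is_deriveZ (d u u01).
    by have := is_derive_monomial (M / n.+1%:R) n u; rewrite divfK ?pnatr_eq0.
  have h1 u : u \in `]0, 1[%R -> derivable g u 1.
    rewrite in_itv/= => /andP[u0 u1].
    by have [] := dg u; rewrite ?(ltW u0) ?(ltW u1).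
  have h2 u : u \in `]0, 1[%R -> 0 <= (g : R -> R)^`()%classic u.
    rewrite in_itv/= => /andP[/ltW u0 /ltW u1].
    have u01 : 0 <= u <= 1 by rewrite u0 u1.
    rewrite derive1E; have [_ ->] := dg u u01.
    by rewrite subr_ge0 (le_trans (ler_norm _))// normrM e1 mul1r le.
  have h3 : {within `[0, 1], continuous g}.
    apply: derivable_within_continuous => u; rewrite in_itv/= => u01.
    by have [] := dg u u01.
  have m0 : 0 \in `[0, 1 : R]%R by rewrite in_itv/= lexx ler01.
  have m1 : 1 \in `[0, 1 : R]%R by rewrite in_itv/= lexx ler01.
  have : g 0 <= g 1 := ger0_derive1_le_cc h1 h2 h3 m0 m1 ler01.
  rewrite -subr_ge0 => h; rewrite -subr_ge0.
  have -> : M / n.+1%:R - e * (f 1 - f 0) = g 1 - g 0 => //.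
  by rewrite /g (expr0n R n.+1) expr1n /=; ring.
rewrite ler_norml; apply/andP; split.
  by have := key (-1); rewrite normrN1 mulN1r lerNl => /(_ erefl).
by have := key 1; rewrite normr1 mul1r => /(_ erefl).
Qed.

Lemma is_derive_ln_sqr (P Q : R -> R) (p q u : R) :
  is_derive u 1 P p -> is_derive u 1 Q q -> 0 < P u ^+ 2 + Q u ^+ 2 ->
  is_derive u 1 (fun u => ln (P u ^+ 2 + Q u ^+ 2) / 2)
    ((P u * p + Q u * q) / (P u ^+ 2 + Q u ^+ 2)).
Proof.
move=> dP dQ /[dup] pq /is_derive1_ln dl.
apply: is_derive_eq; rewrite /GRing.scale /=; field.
by rewrite gt_eqF.
Qed.

Lemma is_derive_atan_div (P Q : R -> R) (p q u : R) :
  is_derive u 1 P p -> is_derive u 1 Q q -> 0 < P u ->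
  is_derive u 1 (fun u => atan (Q u / P u))
    ((q * P u - Q u * p) / (P u ^+ 2 + Q u ^+ 2)).
Proof.
move=> dP dQ P0; have Pn0 : P u != 0 by rewrite gt_eqF.
have dV := is_deriveV Pn0 dP.
apply: is_derive_eq; rewrite /GRing.scale /=; field.
by rewrite Pn0 gt_eqF// ltr_wpDr ?sqr_ge0// exprn_gt0.
Qed.

Lemma Re_divc z (p q : R) : Re (z / (p +i* q)) =
  (Re z * p + Im z * q) / (p ^+ 2 + q ^+ 2).
Proof. by rewrite ReM /= mulrN opprK mulrDl !mulrA. Qed.

Lemma Im_divc z (p q : R) : Im (z / (p +i* q)) =
  (Im z * p - Re z * q) / (p ^+ 2 + q ^+ 2).
Proof. by rewrite ImM /= mulrN addrC mulrBl !mulrA. Qed.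

(** Along u |-> u z the derivative of the sum of [log_psum n] and log (1 - .) is
    D(u) = - z (z u)^n / (1 - z u), by the formula for geometric sums, and
    |1 - z u| >= Re (1 - z u) >= d. *)
Lemma log_psum_bound n z (d : R) : 0 < d ->
  (forall u, 0 <= u <= 1 -> d <= 1 - Re z * u) -> cmod z <= 1 ->
  `|Re (log_psum n z + clog (1 - z))| <= d^-1 / n.+1%:R /\
  `|Im (log_psum n z + clog (1 - z))| <= d^-1 / n.+1%:R.
Proof.
move=> d0 hd z1.
pose P u := 1 - Re z * u.
pose Q u := - (Im z * u).
have PQ u : 1 - z * u%:C = P u +i* Q u.
  by apply/eqP; rewrite eq_complex ReD ImD ReN ImN ReM ImM /= !mulr0 subr0 !add0r !eqxx.
have P0 u : 0 <= u <= 1 -> 0 < P u by move=> u01; rewrite (lt_le_trans d0)// hd.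
have dne u : 0 <= u <= 1 -> 1 - z * u%:C != 0.
  move=> u01; apply/eqP => /(congr1 (@complex.Re R)); rewrite PQ /= => /eqP.
  by rewrite gt_eqF// P0.
pose D u : R[i] := - z * (z * u%:C) ^+ n / (1 - z * u%:C).
have dD u : 0 <= u <= 1 -> cmod (D u) <= d^-1 * u ^+ n.
  move=> /[dup] u01 /andP[u0 u1].
  rewrite /D 2!cmodM cmodX cmodV cmodM cmod_real ger0_norm// exprMn.
  have -> : cmod (- z) = cmod z by rewrite /cmod normrN.
  have cd : d <= cmod (1 - z * u%:C).
    apply: le_trans (normr_Re_le _); rewrite PQ /= (le_trans _ (ler_norm _))//.
    exact: hd.
  rewrite mulrA -exprS mulrAC ler_wpM2r ?exprn_ge0//.
  apply: (@le_trans _ _ (cmod (1 - z * u%:C))^-1).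
    by rewrite ler_piMl ?invr_ge0 ?cmod_ge0// exprn_ile1// cmod_ge0.
  by rewrite lef_pV2 ?posrE// (lt_le_trans d0).
have DE u : 0 <= u <= 1 ->
    D u = \sum_(0 <= k < n) z ^+ k.+1 * (u ^+ k)%:C - z / (P u +i* Q u).
  move=> u01; rewrite -PQ /D mulNr mulNr -mulrA -mulrN.
  have := geometric_remainder n (dne u u01); rewrite mulNr => <-.
  rewrite mulrBr mulr_sumr; congr (_ - _); apply: eq_bigr => k _.
  by rewrite exprMn -realX exprS mulrA.
have ReE u : 0 <= u <= 1 -> Re (D u) = \sum_(0 <= k < n) Re (z ^+ k.+1) * u ^+ k
    - (Re z * P u + Im z * Q u) / (P u ^+ 2 + Q u ^+ 2).
  move=> u01; rewrite DE// ReD ReN Re_sum; congr (_ - _).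
    by apply: eq_bigr => k _; rewrite ReM /= mulr0 subr0.
  exact: Re_divc.
have ImE u : 0 <= u <= 1 -> Im (D u) = \sum_(0 <= k < n) Im (z ^+ k.+1) * u ^+ k
    - (Im z * P u - Re z * Q u) / (P u ^+ 2 + Q u ^+ 2).
  move=> u01; rewrite DE// ImD ImN Im_sum; congr (_ - _).
    by apply: eq_bigr => k _; rewrite ImM /= mulr0 add0r.
  exact: Im_divc.
have PQ0 u : 0 <= u <= 1 -> 0 < P u ^+ 2 + Q u ^+ 2.
  by move=> u01; rewrite ltr_wpDr ?sqr_ge0// exprn_gt0// P0.
have dP u : is_derive u 1 P (- Re z).
  by apply: is_derive_eq; rewrite /GRing.scale /=; ring.
have dQ u : is_derive u 1 Q (- Im z).
  by apply: is_derive_eq; rewrite /GRing.scale /=; ring.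
have dRe u : 0 <= u <= 1 -> is_derive u 1
    (fun u => \sum_(0 <= k < n) Re (z ^+ k.+1) / k.+1%:R * u ^+ k.+1 +
      ln (P u ^+ 2 + Q u ^+ 2) / 2) (Re (D u)).
  move=> u01; rewrite ReE//.
  apply: is_deriveD; first exact: is_derive_psum.
  apply: is_derive_eq; first exact: is_derive_ln_sqr (dP u) (dQ u) (PQ0 u u01).
  by rewrite -[RHS]mulNr; congr (_ / _); ring.
have dIm u : 0 <= u <= 1 -> is_derive u 1
    (fun u => \sum_(0 <= k < n) Im (z ^+ k.+1) / k.+1%:R * u ^+ k.+1 +
      atan (Q u / P u)) (Im (D u)).
  move=> u01; rewrite ImE//.
  apply: is_deriveD; first exact: is_derive_psum.
  apply: is_derive_eq; first exact: is_derive_atan_div (dP u) (dQ u) (P0 u u01).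
  by rewrite -[RHS]mulNr; congr (_ / _); ring.
(* At u = 0 both functions vanish; at u = 1 they give the two components. *)
have sum0 (c : nat -> R) : \sum_(0 <= k < n) c k / k.+1%:R * 0 ^+ k.+1 = 0.
  by rewrite big1// => k _; rewrite expr0n mulr0.
have Q0 : Q 0 = 0 by rewrite /Q mulr0 oppr0.
have P00 : P 0 = 1 by rewrite /P mulr0 subr0.
have z1E : 1 - z = P 1 +i* Q 1 by rewrite -PQ mulr1.
have l01 : 0 <= (1 : R) <= 1 by rewrite ler01 lexx.
split.
- have := small_derivative_bound dRe (fun u u01 => le_trans (normr_Re_le _) (dD u u01)).
  rewrite sum0 Q0 P00 expr0n expr1n addr0 ln1 mul0r addr0 subr0.
  by rewrite -Re_log_psum mulr1 ReD z1E clogE ?P0.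
- have := small_derivative_bound dIm (fun u u01 => le_trans (normr_Im_le _) (dD u u01)).
  rewrite sum0 Q0 mul0r atan0 addr0 subr0.
  by rewrite -Im_log_psum mulr1 ImD z1E clogE ?P0.
Qed.


(** If |z| <= 1 and z <> 1, then Re z < 1, so that Re (1 - z u) is bounded below
    on [0, 1] by a positive constant, and [log_psum_bound] applies even for |z| = 1. *)
Lemma log_series_cvg z : cmod z <= 1 -> z != 1 ->
  ccvg (log_psum ^~ z) (- clog (1 - z)).
Proof.
move=> z1 zn1.
have a1 : Re z <= 1 by rewrite (le_trans (ler_norm _))// (le_trans (normr_Re_le _)).
have an1 : Re z != 1.
  apply: contra_neq zn1 => a1E; apply/eqP; rewrite eq_complex a1E eqxx/=.
  have : cmod z ^+ 2 <= 1 by rewrite exprn_ile1 ?cmod_ge0.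
  by rewrite cmod_sqr a1E expr1n gerDl real_exprn_even_le0//= num_real.
have d0 : 0 < Num.min 1 (1 - Re z).
  by rewrite lt_min ltr01 subr_gt0 lt_neqAle an1.
have hd u : 0 <= u <= 1 -> Num.min 1 (1 - Re z) <= 1 - Re z * u.
  move=> /andP[u0 u1]; have [a0|a0] := leP 0 (Re z).
    by rewrite ge_min; apply/orP; right; rewrite lerD2l lerN2 ler_piMr.
  rewrite ge_min; apply/orP; left; rewrite lerDl oppr_ge0.
  by rewrite mulr_le0_ge0// ltW.
set d := Num.min _ _ in d0 hd.
have dh : (fun n => d^-1 / n.+1%:R) @ \oo --> (0 : R).
  by rewrite -[X in _ --> X](mulr0 d^-1); apply: cvgMr; exact: cvg_harmonic.
have key (x : nat -> R) l : (forall n, `|x n + l| <= d^-1 / n.+1%:R) ->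
    x @ \oo --> - l.
  move=> xl; apply/cvgrPdist_lt => e e0; near=> n.
  rewrite -opprD normrN addrC (le_lt_trans (xl n))//.
  have : `|0 - d^-1 / n.+1%:R| < e.
    by near: n; move: dh => /cvgrPdist_lt; exact.
  by rewrite sub0r normrN ger0_norm// divr_ge0// invr_ge0 ltW.
have h n := log_psum_bound n d0 hd z1.
split; rewrite ?ReN ?ImN; apply: key => n.
  by rewrite -ReD; exact: (h n).1.
by rewrite -ImD; exact: (h n).2.
Unshelve. all: by end_near. Qed.

(** Nonnegative terms: the partial sums increase to the limit. *)
Lemma real_psum_le r n : 0 <= r < 1 ->
  \sum_(0 <= k < n) r ^+ k.+1 / k.+1%:R <= - ln (1 - r).
Proof.
move=> /andP[r0 r1].
have h : cmod r%:C <= 1 by rewrite cmod_real ger0_norm// ltW.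
have hn : (r%:C : R[i]) != 1 by apply/eqP => -[/eqP]; rewrite lt_eqF.
have [c _] := log_series_cvg h hn.
have E m : Re (log_psum m r%:C) = \sum_(0 <= k < m) r ^+ k.+1 / k.+1%:R.
  rewrite Re_sum; apply: eq_bigr => k _.
  by rewrite Re_divn realX.
have rE : (1 : R[i]) - r%:C = (1 - r) +i* 0.
  by apply/eqP; rewrite eq_complex /= subr0 !eqxx.
have LE : Re (- clog (1 - r%:C)) = - ln (1 - r).
  rewrite rE ReN clogE ?subr_gt0//= expr0n addr0 lnXn ?subr_gt0//.
  by rewrite -[_ *+ 2]mulr_natr mulfK.
rewrite -LE -E.
rewrite -(cvg_lim _ c)//; apply: nondecreasing_cvgn_le.
  apply/nondecreasing_seqP => m; rewrite !E big_nat_recr//= lerDl.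
  by rewrite divr_ge0 ?exprn_ge0.
by apply/cvg_ex; eexists; exact: c.
Qed.

End LogSeries.

(** * Uniform bounds for the partial sums along a segment of the disc *)

Section Domination.
Context {R : realType}.
Notation mu := (@lebesgue_measure R).
Notation Re := complex.Re.
Notation Im := complex.Im.
Implicit Types (a e w x s z : R[i]) (r t v : R).

(** The quantitative form of the strict convexity of the unit disc. *)
Lemma cmod_segment_sqr a e v : cmod (a + e * v%:C) ^+ 2 =
  (1 - v) * cmod a ^+ 2 + v * cmod (a + e) ^+ 2 - v * (1 - v) * cmod e ^+ 2.
Proof.
rewrite !cmod_sqr !ReD !ImD ReM ImM /=; ring.
Qed.

(** Partial sums of - log (1 - z) / z, written without dividing by z so that
    they make sense at z = 0. *)
Definition div_log_psum n z : R[i] := \sum_(0 <= k < n) z ^+ k / k.+1%:R.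

Lemma mul_div_log_psum n z : z * div_log_psum n z = log_psum n z.
Proof. by rewrite mulr_sumr; apply: eq_bigr => k _; rewrite exprS mulrA. Qed.

Lemma cmod_sum (F : nat -> R[i]) n :
  cmod (\sum_(0 <= k < n) F k) <= \sum_(0 <= k < n) cmod (F k).
Proof.
elim: n => [|n IHn]; first by rewrite !big_geq// cmodE /= !expr0n addr0 sqrtr0.
by rewrite !big_nat_recr//= (le_trans (cmodD _ _))// lerD2r.
Qed.

(** Apart from the term 1, the terms satisfy |z|^k / (k + 1) <= |z|^k / k. *)
Lemma cmod_div_log_psum_le n z : cmod z < 1 ->
  cmod (div_log_psum n z) <= 1 - ln (1 - cmod z).
Proof.
move=> z1; have r0 := cmod_ge0 z.
have lr0 : 0 <= - ln (1 - cmod z) by rewrite oppr_ge0 ln_le0// gerBl.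
apply: le_trans (cmod_sum _ _) _.
case: n => [|n]; first by rewrite big_geq// addr_ge0.
rewrite big_nat_recl//= expr0 divr1 (cmod_nat 1) lerD2l.
apply: le_trans (real_psum_le n _); last by rewrite r0 z1.
rewrite !big_mkord; apply: ler_sum => k _.
rewrite cmodM cmodV cmod_nat cmodX ler_wpM2l ?exprn_ge0//.
by rewrite lef_pV2 ?posrE// ler_nat.
Qed.

(** From 1 + y <= e^y with y = - c ln t. *)
Lemma log_le_power t c : 0 < c -> 0 < t <= 1 ->
  1 - ln t <= (1 + c^-1) * expR (- c * ln t).
Proof.
move=> c0 /andP[t0 t1]; have l0 : ln t <= 0 by exact: ln_le0.
have h1 : 1 <= expR (- c * ln t).
  by rewrite -(@expR0 R) ler_expR mulr_le0// oppr_le0 ltW.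
have h2 : 1 + - c * ln t <= expR (- c * ln t) by exact: expR_ge1Dx.
have h3 : - ln t <= c^-1 * expR (- c * ln t).
  by rewrite ler_pdivlMl// (le_trans _ h2)// mulrN mulNr lerDr.
by rewrite mulrDl mul1r lerD.
Qed.

Lemma mul_Nln_le v : 0 < v -> v * - ln v <= 1 - v.
Proof.
move=> v0; have vV0 : 0 < v^-1 by rewrite invr_gt0.
have := ln_le_subr1 vV0; rewrite lnV ?posrE// -(ler_pM2l v0).
by rewrite mulrBr mulr1 divff ?gt_eqF.
Qed.

Lemma rlog_kernelM (a b c d : R) v :
  rlog_kernel a b v * rlog_kernel c d v = rlog_kernel (a + c - 1) (b + d - 1) v.
Proof.
by rewrite /rlog_kernel -!expRD; congr expR; ring.
Qed.

(** With h = |e|^2 / 2, strict convexity gives 1 - |z|^2 >= 2 h v (1 - v), hence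
    1 - |z| >= h v (1 - v) >= h v^2 (- ln v).  The partial sums are at most
    1 - ln (1 - |z|), which is O((1 - |z|)^(-c)). *)
Lemma segment_psum_bound w e c : 0 < c -> cmod w <= 1 -> cmod (w + e) <= 1 ->
  e != 0 -> exists K, forall n v, 0 < v < 1 ->
  cmod (div_log_psum n (w + e * v%:C)) <= K * rlog_kernel (1 - c) (1 - 2 * c) v.
Proof.
move=> c0 w1 we1 e0.
pose h := cmod e ^+ 2 / 2.
have h0 : 0 < h by rewrite divr_gt0// exprn_gt0// lt_neqAle cmod_ge0 eq_sym cmod_eq0 e0.
exists ((1 + c^-1) * expR (- c * ln h)) => n v /andP[v0 v1].
set r := cmod (w + e * v%:C).
have r0 : 0 <= r by exact: cmod_ge0.
have L0 : 0 < - ln v by rewrite oppr_gt0 ln_lt0// v0.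
have v1' : 0 < 1 - v by rewrite subr_gt0.
have r2 : r ^+ 2 <= 1 - v * (1 - v) * cmod e ^+ 2.
  rewrite cmod_segment_sqr lerD2r.
  have h1 : cmod w ^+ 2 <= 1 by rewrite exprn_ile1 ?cmod_ge0.
  have h2 : cmod (w + e) ^+ 2 <= 1 by rewrite exprn_ile1 ?cmod_ge0.
  have := ler_wpM2l (ltW v1') h1; have := ler_wpM2l (ltW v0) h2.
  rewrite !mulr1; lra.
have vv : 0 < v * (1 - v) * h by do 2 apply: mulr_gt0 => //.
have hE : v * (1 - v) * cmod e ^+ 2 = 2 * (v * (1 - v) * h) by rewrite /h; field.
have r1 : r < 1.
  rewrite ltNge; apply/negP => r1.
  have : 1 <= r ^+ 2 by rewrite exprn_ege1.
  by rewrite leNgt (le_lt_trans r2)// hE ltrBlDr ltrDl mulr_gt0.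
have rh : v * (1 - v) * h <= 1 - r.
  have : 0 <= (1 - r) * (1 - r) by rewrite mulr_ge0// subr_ge0 ltW.
  move: r2; rewrite hE expr2 mulrBl mul1r mulrBr mulr1; lra.
have y0 : 0 < 1 - r by rewrite subr_gt0.
apply: le_trans (cmod_div_log_psum_le _ r1) _.
apply: (le_trans (log_le_power c0 _)); first by rewrite y0 gerBl.
rewrite -mulrA ler_pM2l ?addr_gt0 ?invr_gt0//.
have p1 : 0 < v * - ln v by exact: mulr_gt0.
have p2 : 0 < v * (v * - ln v) by exact: mulr_gt0.
have p3 : 0 < v * (v * - ln v) * h by exact: mulr_gt0.
have E : expR (- c * ln h) * rlog_kernel (1 - c) (1 - 2 * c) v =
    expR (- c * ln (v * (v * - ln v) * h)).
  have -> : ln (v * (v * - ln v) * h) = ln v + (ln v + ln (- ln v)) + ln h.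
    by rewrite lnM ?posrE// lnM ?posrE// lnM ?posrE.
  by rewrite /rlog_kernel -!expRD; congr expR; ring.
rewrite E ler_expR ler_nM2l ?oppr_lt0// ler_ln ?posrE//.
apply: le_trans rh; rewrite ler_pM2r// ler_pM2l//.
exact: mul_Nln_le.
Qed.

Lemma const_psum_bound w : w != 0 -> w != 1 -> cmod w <= 1 ->
  exists K, forall n, cmod (div_log_psum n w) <= K.
Proof.
move=> w0 w1 wle.
have [cR cI] := log_series_cvg wle w1.
have bnd (u : nat -> R) (l : R) : u @ \oo --> l -> exists M, forall n, `|u n| <= M.
  move=> ul; have : cvgn u by apply/cvg_ex; exists l.
  move=> /cvg_seq_bounded [M [_ h]]; exists (M + 1) => n.
  by apply: h => //; rewrite ltrDl.
have [M1 h1] := bnd _ _ cR; have [M2 h2] := bnd _ _ cI.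
exists ((cmod w)^-1 * (M1 + M2)) => n.
rewrite ler_pdivlMl; last by rewrite lt_neqAle cmod_ge0 eq_sym cmod_eq0 w0.
by rewrite -cmodM mul_div_log_psum (le_trans (cmod_le _))// lerD.
Qed.

End Domination.

(** * Termwise integration *)

Section PointwiseLimit.
Context {R : realType}.
Notation mu := (@lebesgue_measure R).
Notation Re := complex.Re.
Notation Im := complex.Im.
Implicit Types (a e w x s z : R[i]) (r t v : R).

(** If x <> 0, the exponent c of [segment_psum_bound] must satisfy c < rho and
    2 c < 1 for the dominating function to be integrable at both ends. *)
Lemma kernel_psum_dominated w x (rho : R) : 0 < rho -> w != 0 ->
  cmod w <= 1 -> cmod (w * (1 + x)) <= 1 -> ~ (w = 1 /\ x = 0) ->
  exists2 g : R -> R, mu.-integrable `]0, 1[ (EFin \o g) &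
  forall n v, 0 < v < 1 ->
    rlog_kernel rho 1 v * cmod (div_log_psum n (w * (1 + x * v%:C))) <= g v.
Proof.
move=> rho0 w0 w1 wx1 ne.
have mD : measurable (`]0, 1[%classic : set (measurableTypeR R)).
  exact: measurable_itv.
have [x0|x0] := eqVneq x 0.
  have wn1 : w != 1 by apply/eqP => wE; apply: ne.
  have [K hK] := const_psum_bound w0 wn1 w1.
  exists (fun v => K * rlog_kernel rho 1 v).
    apply: integrable_scale => //; exact: rlog_kernel_integrable.
  move=> n v _; rewrite x0 mul0r addr0 mulr1 mulrC ler_wpM2r//.
  by rewrite mulr_ge0 ?expR_ge0.
(* The bound 1/4 keeps the exponent 1 - 2 c of v positive. *)
pose c := Num.min (rho / 2) (4^-1).
have c0 : 0 < c by rewrite lt_min divr_gt0//= invr_gt0.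
have crho : c <= rho / 2 by rewrite ge_min lexx.
have c4 : c <= 4^-1 by rewrite ge_min lexx orbT.
have e0 : w * x != 0 by rewrite mulf_neq0.
have wx1' : cmod (w + w * x) <= 1 by rewrite -[X in X + _]mulr1 -mulrDr.
have [K hK] := segment_psum_bound c0 w1 wx1' e0.
exists (fun v => K * rlog_kernel (rho - c) (1 - 2 * c) v).
  by apply: integrable_scale => //; apply: rlog_kernel_integrable; lra.
move=> n v v01; have := hK n v v01.
have -> : w + w * x * v%:C = w * (1 + x * v%:C) by rewrite mulrDr mulr1 mulrA.
move=> h; have k0 : 0 <= rlog_kernel rho 1 v by rewrite mulr_ge0 ?expR_ge0.
apply: le_trans (ler_wpM2l k0 h) _.
rewrite mulrCA rlog_kernelM.
have -> : rho + (1 - c) - 1 = rho - c by ring.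
by have -> : 1 + (1 - 2 * c) - 1 = 1 - 2 * c by ring.
Qed.

(** The number 1 is an extreme point of the disc, so the open segment from w to
    w (1 + x) meets it only if w = 1 and x = 0. *)
Lemma segment_interior w x v : 0 < v < 1 ->
  cmod w <= 1 -> cmod (w * (1 + x)) <= 1 -> ~ (w = 1 /\ x = 0) -> w != 0 ->
  cmod (w * (1 + x * v%:C)) <= 1 /\ w * (1 + x * v%:C) != 1.
Proof.
move=> /andP[v0 v1] w1 wx1 ne w0.
have v1' : 0 < 1 - v by rewrite subr_gt0.
have E : w * (1 + x * v%:C) = w + w * x * v%:C by rewrite mulrDr mulr1 mulrA.
have sq : cmod (w * (1 + x * v%:C)) ^+ 2 <= 1 - v * (1 - v) * cmod (w * x) ^+ 2.
  rewrite E cmod_segment_sqr lerD2r.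
  have h1 : cmod w ^+ 2 <= 1 by rewrite exprn_ile1 ?cmod_ge0.
  have h2 : cmod (w + w * x) ^+ 2 <= 1.
    by rewrite -[X in X + _]mulr1 -mulrDr exprn_ile1 ?cmod_ge0.
  have := ler_wpM2l (ltW v1') h1; have := ler_wpM2l (ltW v0) h2.
  rewrite !mulr1; lra.
have p0 : 0 <= v * (1 - v) * cmod (w * x) ^+ 2.
  by rewrite mulr_ge0 ?sqr_ge0// mulr_ge0 ?ltW.
split.
  rewrite -(@expr_le1 _ 2)// ?cmod_ge0//; lra.
apply/eqP => Z1.
have [x0|x0] := eqVneq x 0.
  by apply: ne; split => //; rewrite -Z1 x0 mul0r addr0 mulr1.
move: sq; rewrite Z1 (cmod_nat 1) expr1n lerBrDr gerDl leNgt mulr_gt0 ?mulr_gt0//.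
by rewrite lt_neqAle cmod_ge0 eq_sym cmod_eq0 mulf_neq0.
by rewrite lt_neqAle cmod_ge0 eq_sym cmod_eq0 mulf_neq0.
Qed.

Lemma div_log_psum_cvg z : cmod z <= 1 -> z != 1 -> z != 0 ->
  ccvg (div_log_psum ^~ z) (- clog (1 - z) / z).
Proof.
move=> z1 zn1 z0.
have := ccvgM (log_series_cvg z1 zn1) (ccvg_cst z^-1).
rewrite (_ : (fun n => _) = div_log_psum ^~ z)//; apply/funext => n.
by rewrite -mul_div_log_psum mulrC mulKf.
Qed.

Lemma log_kernel_nat s n v : 0 < v ->
  log_kernel s n.+1%:R v = log_kernel s 1 v * v%:C ^+ n.
Proof.
move=> v0; rewrite /log_kernel subrr mul0r expR0 mulr1; congr (_ * _).
rewrite -natr1 addrK -rmorphXn; congr (_%:C).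
by rewrite mulrC expRM_natr lnK ?posrE.
Qed.

(** Expand (1 + x v)^n and integrate each power of v. *)
Lemma integral_kernel_binomial s x n : 0 < Re s ->
  cintegrable `]0, 1[ (fun v => log_kernel s 1 v * (1 + x * v%:C) ^+ n) /\
  cintegral `]0, 1[ (fun v => log_kernel s 1 v * (1 + x * v%:C) ^+ n) =
  cGamma s * \sum_(k < n.+1) 'C(n, k)%:R * (x ^+ k / polar_pow k.+1%:R 0 s).
Proof.
move=> s0.
have mD : measurable (`]0, 1[%classic : set (measurableTypeR R)).
  exact: measurable_itv.
pose F k v : R[i] := 'C(n, k)%:R * x ^+ k * log_kernel s k.+1%:R v.
have E v : `]0, 1[%classic v -> \sum_(0 <= k < n.+1) F k v =
    log_kernel s 1 v * (1 + x * v%:C) ^+ n.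
  rewrite /= in_itv/= => /andP[v0 _]; rewrite exprDn mulr_sumr big_mkord.
  apply: eq_bigr => k _; rewrite /F expr1n mul1r exprMn log_kernel_nat//.
  by rewrite -[_ *+ _]mulr_natl; ring.
have ik k : cintegrable `]0, 1[ (log_kernel s k.+1%:R) by apply: (integral_log_kernel s0 _).1.
have iF k : cintegrable `]0, 1[ (F k) by exact: cintegrableZl.
have [i e] := cintegral_sum n.+1 mD iF.
split; first exact: eq_cintegrable E i.
rewrite -(eq_cintegral E) e big_mkord mulr_sumr; apply: eq_bigr => k _.
rewrite cintegralZl// (integral_log_kernel s0 _).2//.
ring.
Qed.

Lemma psum_measurable w x n :
  cmeasurable setT (fun v => div_log_psum n (w * (1 + x * v%:C))).
Proof.
apply: cmeasurable_sum => k; apply: cmeasurableM; last exact: cmeasurable_cst.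
apply: cmeasurableX; apply: cmeasurableM; first exact: cmeasurable_cst.
apply: cmeasurableD; first exact: cmeasurable_cst.
apply: cmeasurableM; first exact: cmeasurable_cst.
by apply: cmeasurable_real; exact: measurable_id.
Qed.

(** Measurability has to be extended to the removed point before the integrals
    can be compared. *)
Lemma cintegral_setD1 (D : set (measurableTypeR R)) (f : R -> R[i]) v0 :
  measurable D -> cintegrable (D `\ v0) f ->
  cintegrable D f /\ cintegral (D `\ v0) f = cintegral D f.
Proof.
move=> mD if0.
have m1 : measurable ([set v0] : set (measurableTypeR R)) by exact: measurable_set1.
have mD1 : measurable (D `\ v0 : set (measurableTypeR R)) by exact: measurableD.
have z1 : mu [set v0] = 0%E by exact: lebesgue_measure_set1.
have [mR mI] := cintegrable_measurable if0.
have ext (p : R -> R) :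
    measurable_fun (D `\ v0) (p : measurableTypeR R -> R) ->
    measurable_fun D (p : measurableTypeR R -> R).
  move=> mp; apply: (@measurable_funS _ _ (measurableTypeR R) _ ((D `\ v0) `|` [set v0])).
  - exact: measurableU.
  - by move=> v Dv /=; have [->|/eqP] := eqVneq v v0; [right|left].
  - apply/measurable_funU => //; split => //; exact: measurable_fun_set1.
have ext_int (p : R -> R) : measurable_fun (D `\ v0) (p : measurableTypeR R -> R) ->
    mu.-integrable (D `\ v0) (EFin \o p) -> mu.-integrable D (EFin \o p) /\
    Rintegral mu (D `\ v0) p = Rintegral mu D p.
  move=> mp ip; have iD : mu.-integrable D (EFin \o p).
    by apply/(negligible_integrable m1 mD _ z1) => //; apply/measurable_EFinP; exact: ext.
  split => //; rewrite /Rintegral; congr fine.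
  by rewrite [RHS](negligible_integral m1 mD iD z1).
have [iR eR] := ext_int _ mR if0.1; have [iI eI] := ext_int _ mI if0.2.
by split; [split|congr (_ +i* _)].
Qed.

(** The quotient by z(v) is the sum of the series only where z(v) <> 0, so the
    limit is taken on ]0, 1[ minus the only point where 1 + x v can vanish. *)
Lemma integral_log_limit s w x : 0 < Re s -> w != 0 -> cmod w <= 1 ->
  cmod (w * (1 + x)) <= 1 -> ~ (w = 1 /\ x = 0) ->
  let Z v := w * (1 + x * v%:C) in
  let f v := log_kernel s 1 v * (- clog (1 - Z v) / Z v) in
  cintegrable `]0, 1[ f /\
  ccvg (fun n => cintegral `]0, 1[ (fun v => log_kernel s 1 v * div_log_psum n (Z v)))
    (cintegral `]0, 1[ f).
Proof.
move=> s0 w0 w1 wx1 ne Z f.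
have mD : measurable (`]0, 1[%classic : set (measurableTypeR R)).
  exact: measurable_itv.
(* If 1 + x v = 0 with v real, then v = v0; if x = 0, removing v0 is harmless. *)
pose v0 := Re (- x^-1).
pose D0 : set (measurableTypeR R) := `]0, 1[%classic `\ v0.
have mD0 : measurable D0 by apply: measurableD => //; exact: measurable_set1.
have Zn0 v : D0 v -> Z v != 0.
  move=> [_ /= vv0]; rewrite mulf_neq0//; apply: contra_not_neq vv0 => u0.
  have x0 : x != 0.
    by apply: contra_eq_neq u0 => ->; rewrite mul0r addr0 oner_eq0.
  have xv : x * v%:C = -1 by apply/eqP; rewrite -addr_eq0 addrC u0.
  by rewrite /v0 -mulN1r -xv mulrAC divff// mul1r.
have [g ig hg] := kernel_psum_dominated s0 w0 w1 wx1 ne.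
pose F n v := log_kernel s 1 v * div_log_psum n (Z v).
have ck := cintegrable_measurable (integral_log_kernel s0 ltr01).1.
have mF n : cmeasurable `]0, 1[ (F n).
  apply: cmeasurableM => //.
  by have [m1 m2] := psum_measurable w x n; split; apply: measurable_funTS.
have Fg n v : `]0, 1[%classic v -> cmod (F n v) <= g v.
  rewrite /= in_itv/= => v01; rewrite cmodM cmod_log_kernel; exact: hg.
have iF n : cintegrable `]0, 1[ (F n) by apply: cintegrable_le (Fg n) ig.
have sub : D0 `<=` `]0, 1[ by move=> v [].
have [if0 cf0] : cintegrable D0 f /\ ccvg (fun n => cintegral D0 (F n)) (cintegral D0 f).
  apply: (@cdominated_convergence _ _ _ _ g) => //.
  - by move=> n; have [m1 m2] := mF n; split; apply: measurable_funS sub _.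
  - move=> v /[dup] D0v [/=]; rewrite in_itv/= => v01 _.
    have [Z1 Zn1] := segment_interior v01 w1 wx1 ne w0.
    apply: ccvgM; first exact: ccvg_cst.
    exact: div_log_psum_cvg (Zn0 v D0v).
  - exact: integrableS sub ig.
  - by move=> n v /sub; exact: Fg.
have [if1 e1] := cintegral_setD1 mD if0.
split => //; rewrite -e1.
rewrite (_ : (fun n => _) = (fun n => cintegral D0 (F n)))//.
apply/funext => n.
have iF0 : cintegrable D0 (F n).
  by have [i1 i2] := iF n; split; exact: integrableS sub _.
by have [_ ->] := cintegral_setD1 mD iF0.
Qed.

End PointwiseLimit.

(** * The integral representation of the series *)

Theorem theorem4p6 (R : realType) (s w x : R[i]) (theta : R)
  (hs : 1 < complex.Re s)
  (* theta is an argument of -1, so that - theta is one of log v, 0 < v < 1 *)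
  (htheta : cos theta +i* sin theta = -1)
  (hw0 : w <> 0)
  (hw : `|w| <= 1)
  (hwx : `|w * (1 + x)| <= 1)
  (hne : ~ (w = 1 /\ x = 0)) :
  cintegrable `]0, 1[ (rhs_integrand (- theta) w x s) /\
  series (fun n : nat =>
      (w ^+ n / n.+1%:R *
       (\sum_(k < n.+1)
          'C(n, k)%:R * (x ^+ k / polar_pow k.+1%:R 0 (s - 1))) : R[i]^o))
    @ \oo -->
    (polar_pow 1 theta (s - 1) / (w * cGamma (s - 1)) *
       cintegral `]0, 1[ (rhs_integrand (- theta) w x s) : R[i]^o).
Proof.
have s0 : 0 < complex.Re (s - 1) by rewrite ReD ReN subr_gt0.
have w0 : w != 0 by exact/eqP.
have G0 := cGamma_neq0 s0.
have mD : measurable (`]0, 1[%classic : set (measurableTypeR R)).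
  exact: measurable_itv.
have [] := integral_log_limit s0 w0 (cmod_le1 hw) (cmod_le1 hwx) hne.
set Z := fun v : R => w * (1 + x * v%:C).
set f := fun v : R => _ * (- clog _ / _) => fi fc.
(* The integrand is a constant multiple of f, also where 1 + x v = 0, since both
   sides are then 0. *)
pose c0 := polar_pow 1 (- theta) (s - 2%:R) * - w.
have rhsE v : `]0, 1[%classic v -> c0 * f v = rhs_integrand (- theta) w x s v.
  rewrite /= in_itv/= => /andP[v0 v1].
  have L0 : 0 < - ln v by rewrite oppr_gt0 ln_lt0// v0.
  rewrite /rhs_integrand ltr0_norm -?oppr_gt0//.
  have -> : polar_pow (- ln v) (- theta) (s - 2%:R) =
      polar_pow 1 (- theta) (s - 2%:R) * polar_pow (- ln v) 0 (s - 2%:R).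
    rewrite /polar_pow -cexpD -mulrDr; congr (cexp (_ * _)).
    by apply/eqP; rewrite eq_complex /= ln1 add0r addr0 !eqxx.
  rewrite /f /log_kernel subrr mul0r expR0 mulr1 /c0 /Z.
  have -> : s - 1 - 1 = s - 2%:R by rewrite -addrA -opprD.
  have -> : (w * (1 + x * v%:C))^-1 = w^-1 * (1 + x * v%:C)^-1 by rewrite invfM.
  by move: (1 + x * v%:C)^-1 => iu; field.
split; first exact: eq_cintegrable rhsE (cintegrableZl _ mD fi).
rewrite -(eq_cintegral rhsE) cintegralZl//.
have phase : polar_pow 1 theta (s - 1) * polar_pow 1 (- theta) (s - 2%:R) = -1.
  rewrite -[RHS]htheta /polar_pow -cexpD.
  have -> : (s - 1) * (ln 1 +i* theta) + (s - 2%:R) * (ln 1 +i* (- theta)) =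
      0 +i* theta.
    have -> : (ln 1 +i* (- theta)) = - (ln 1 +i* theta).
      by apply/eqP; rewrite eq_complex /= ln1 oppr0 !eqxx.
    rewrite mulrN -mulrBl ln1.
    have -> : s - 1 - (s - 2%:R) = 1 by ring.
    by rewrite mul1r.
  by rewrite /cexp /= expR0 !mul1r.
have -> : polar_pow 1 theta (s - 1) / (w * cGamma (s - 1)) *
    (c0 * cintegral `]0, 1[ f) = (cGamma (s - 1))^-1 * cintegral `]0, 1[ f.
  have cancel (A B I : R[i]) : A * B = -1 ->
      A / (w * cGamma (s - 1)) * (B * - w * I) = (cGamma (s - 1))^-1 * I.
    move=> AB; transitivity (- (A * B) / cGamma (s - 1) * I); last first.
      by rewrite AB opprK mul1r.
    by field; rewrite w0 G0.
  exact: cancel.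
have := ccvgM (ccvg_cst (cGamma (s - 1))^-1) fc.
set u := (fun n => _ * _) => -[uR uI].
rewrite (_ : series _ = u); first exact: cvg_complex.
apply/funext => n; rewrite /u.
pose F k v := w ^+ k / k.+1%:R * (log_kernel (s - 1) 1 v * (1 + x * v%:C) ^+ k).
have iF k : cintegrable `]0, 1[ (F k).
  by apply: cintegrableZl => //; apply: (integral_kernel_binomial x k s0).1.
have [_ e] := cintegral_sum n mD iF.
have FE v : `]0, 1[%classic v -> \sum_(0 <= k < n) F k v =
    log_kernel (s - 1) 1 v * div_log_psum n (Z v).
  move=> _; rewrite /div_log_psum mulr_sumr; apply: eq_bigr => k _.
  by rewrite /F /Z exprMn; ring.
rewrite -(eq_cintegral FE) e mulr_sumr; apply: eq_bigr => k _.
have [ik ek] := integral_kernel_binomial x k s0.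
by rewrite cintegralZl// ek mulrCA mulKf.
Qed.
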